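(* Let $P$ be a poset, $\mathbf{k}$ a field, $\varphi:P\times P\to P$ an order-preserving map, and let $A$ be a persistence module indexed by $P$. Let $(K,d)$ be a chain complex of persistence modules that has all terms projective and whose subcomplex of boundaries $B$ also has all terms projective. For all $n\ge 0$, there is a natural short exact sequence $$0\to H_n(K)\otimes_{\varphi} A\to H_n(K\otimes_{\varphi} A)\to \mathbf{Tor}^{\varphi}_1(H_{n-1}(K),A)\to 0.$$ Furthermore the short exact sequence splits, although not naturally.
   Context: A poset $P$ is viewed as a category $\mathbf{P}$ with a unique morphism $p\to q$ iff $p\le q$. A persistence module is a functor $M:\mathbf{P}\to\mathbf{Vect}_{\mathbf{k}}$; with natural transformations they form the abelian category $\mathbf{k}^{\mathbf{P}}$ (kernels, cokernels, direct sums computed pointwise), which has enough projectives. $P\times P$ has the product order. $\varphi$-tensor product: $(M\otimes_\varphi N)_p=\operatorname{colim}_{\varphi(a,b)\le p}M_a\otimes_{\mathbf{k}}N_b$ (colimit over the subposet $\{(a,b)\in P\times P:\varphi(a,b)\le p\}$), with canonical structure maps. It is right exact in each variable. $\mathbf{Tor}^\varphi_i$ denotes its left derived functors; in the claim $\mathbf{Tor}^\varphi_1(M,A)=H_1(Q_\bullet\otimes_\varphi A)$ for a projective resolution $Q_\bullet\to M$. The subcomplex of boundaries of $K$ has terms $\operatorname{im} d_{n+1}\subseteq K_n$. $K\otimes_\varphi A$ is the complex with terms $K_n\otimes_\varphi A$ and differentials $d_n\otimes_\varphi\mathrm{id}_A$. *)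

(* Defs.v *)
From HB Require Import structures.
From mathcomp Require Import all_boot all_order ssralg ssrnum ssrint.
From mathcomp Require Import generic_quotient ring_quotient.
From mathcomp Require Import finmap monalg boolp.

Set Implicit Arguments.
Unset Strict Implicit.
Unset Printing Implicit Defensive.

Import Order.TTheory GRing.Theory Num.Theory.
Local Open Scope quotient_scope.
Local Open Scope ring_scope.

Section LinearAlgebra.
Variable k : fieldType.
Implicit Types U V W : lmodType k.

Definition mklin U V (f : U -> V) (hf : linear f) : {linear U -> V} :=
  HB.pack f (GRing.isLinear.Build k U V *:%R f hf).

Section Sub.
Variables (V : lmodType k) (S : submodClosed V).
Definition submod_type := {x : V | x \in S}.
HB.instance Definition _ := SubChoice.on submod_type.
HB.instance Definition _ := [SubChoice_isSubLmodule of submod_type by <:].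
Definition submod := [the lmodType k of submod_type].
Definition submod_val : {linear submod -> V} :=
  [the {linear submod_type -> V} of (val : submod_type -> V)].
Definition submod_in (x : V) (hx : x \in S) : submod := exist _ x hx.

Lemma submod_valP (x : submod) : submod_val x \in S.
Proof. exact: (valP (x : submod_type)). Qed.
Lemma submod_inK x (hx : x \in S) : submod_val (submod_in hx) = x.
Proof. by []. Qed.
Lemma submod_val_inj : injective submod_val.
Proof. by move=> x y; exact: val_inj. Qed.
End Sub.

Section Ker.
Variables (U V : lmodType k) (f : {linear U -> V}).
Definition lker : {pred U} := fun x => f x == 0.
Lemma lker_submod : submod_closed lker.
Proof.
split; rewrite ?unfold_in /lker ?linear0 // => a x y /eqP hx /eqP hy.
by rewrite unfold_in linearP hx hy scaler0 addr0.
Qed.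
HB.instance Definition _ := GRing.isSubmodClosed.Build k U lker lker_submod.

Definition limg : {pred V} := fun y => `[< exists x, f x = y >].
Lemma limg_submod : submod_closed limg.
Proof.
split=> [|a _ _ /asboolP[x <-] /asboolP[y <-]]; apply/asboolP.
  by exists 0; rewrite linear0.
by exists (a *: x + y); rewrite linearP.
Qed.
HB.instance Definition _ := GRing.isSubmodClosed.Build k V limg limg_submod.

Variable T : submodClosed V.
Definition lpreim : {pred U} := fun x => f x \in T.
Lemma lpreim_submod : submod_closed lpreim.
Proof.
split=> [|a x y hx hy]; rewrite unfold_in ?linear0 ?linearP; first exact: rpred0.
by apply: rpredD => //; apply: rpredZ.
Qed.
HB.instance Definition _ := GRing.isSubmodClosed.Build k U lpreim lpreim_submod.
End Ker.

(* The submodule generated by R. *)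
Section Span.
Variables (V : lmodType k) (R : V -> Prop).
Definition span : {pred V} := fun x =>
  `[< forall S : submodClosed V, (forall r, R r -> r \in S) -> x \in S >].
Lemma span_submod : submod_closed span.
Proof.
split=> [|a x y /asboolP hx /asboolP hy]; apply/asboolP => S hS.
  exact: rpred0.
by apply: rpredD; [apply: rpredZ; exact: hx | exact: hy].
Qed.
HB.instance Definition _ := GRing.isSubmodClosed.Build k V span span_submod.
End Span.


Section Quot.
Variables (V : lmodType k) (S : submodClosed V).
Let S' : {pred V} := S.
Fact quot_zmod : zmod_closed S'.
Proof.
split=> [|x y hx hy]; first exact: rpred0.
by rewrite -scaleN1r; apply: rpredD => //; apply: rpredZ.
Qed.
HB.instance Definition _ := GRing.isZmodClosed.Build V S' quot_zmod.
Definition quot_type := Quotient.quot S'.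
HB.instance Definition _ := GRing.Zmodule.on quot_type.
HB.instance Definition _ := EqQuotient.on quot_type.

Let mk (x : V) : quot_type := \pi_quot_type x.

Let mk_eq x y : mk x = mk y <-> x - y \in S.
Proof.
rewrite -[x - y \in S]/(x - y \in S') (Quotient.idealrBE S').
by split=> [h|/eqP h]; [apply/eqP | exact: h].
Qed.

Let mkK (q : quot_type) : mk (repr q) = q.
Proof. exact: reprK. Qed.

Let mkD x y : mk (x + y) = mk x + mk y.
Proof. by rewrite /mk piE. Qed.

Let qscale (a : k) (q : quot_type) : quot_type := mk (a *: repr q).

Let qscale_mk a x : qscale a (mk x) = mk (a *: x).
Proof. by apply/mk_eq; rewrite -scalerBr; apply/rpredZ/mk_eq; rewrite mkK. Qed.

Fact qscaleA a b q : qscale a (qscale b q) = qscale (a * b) q.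
Proof. by rewrite -[q]mkK !qscale_mk scalerA. Qed.
Fact qscale1 : left_id 1 qscale.
Proof. by move=> q; rewrite -[q]mkK qscale_mk scale1r. Qed.
Fact qscaleDr : right_distributive qscale +%R.
Proof.
by move=> a q r; rewrite -[q]mkK -[r]mkK -mkD !qscale_mk -mkD scalerDr.
Qed.
Fact qscaleDl q : {morph qscale^~ q : a b / a + b}.
Proof. by move=> a b; rewrite -[q]mkK !qscale_mk -mkD scalerDl. Qed.

HB.instance Definition _ :=
  GRing.Zmodule_isLmodule.Build k quot_type qscaleA qscale1 qscaleDr qscaleDl.

Definition quot := [the lmodType k of quot_type].

Fact quotmk_is_linear : linear (mk : V -> quot).
Proof. by move=> a x y; rewrite mkD; congr (_ + _); rewrite -qscale_mk. Qed.
Definition quotmk : {linear V -> quot} := mklin quotmk_is_linear.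

Lemma quotmk_eq x y : quotmk x = quotmk y <-> x - y \in S.
Proof. exact: mk_eq. Qed.

Lemma quotP (q : quot) : exists x, q = quotmk x.
Proof. by exists (repr (q : quot_type)); rewrite /= mkK. Qed.

Section Lift.
Variables (U : lmodType k) (f : {linear V -> U}).
Hypothesis hf : forall x, x \in S -> f x = 0.

Let lift_mk x : f (repr (mk x)) = f x.
Proof.
by apply/eqP; rewrite -subr_eq0 -linearB; apply/eqP/hf/mk_eq; rewrite mkK.
Qed.

Fact quot_lift_is_linear : linear (fun q : quot => f (repr (q : quot_type))).
Proof.
move=> a q r; case: (quotP q) (quotP r) => x -> [y ->].
by rewrite -linearP !lift_mk linearP.
Qed.
Definition quot_lift : {linear quot -> U} := mklin quot_lift_is_linear.

Lemma quot_liftE x : quot_lift (quotmk x) = f x.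
Proof. exact: lift_mk. Qed.
End Lift.

Lemma quot_ext (U : lmodType k) (f g : {linear quot -> U}) :
  (forall x, f (quotmk x) = g (quotmk x)) -> f =1 g.
Proof. by move=> h q; case: (quotP q) => x ->. Qed.

End Quot.

Lemma span_mem V (R : V -> Prop) r : R r -> r \in span R.
Proof. by move=> hr; apply/asboolP => S; apply. Qed.

Lemma span_ker U V (R : V -> Prop) (f : {linear V -> U}) :
  (forall r, R r -> f r = 0) -> forall x, x \in span R -> f x = 0.
Proof.
move=> hf x /asboolP /(_ (lker f)) h; apply/eqP; apply: h => r hr.
exact/eqP/hf.
Qed.

Section Free.
Variable T : choiceType.
Definition free := [the lmodType k of {malg k[T]}].
Definition fgen (t : T) : free := << t >>.

Section Lift.
Variables (U : lmodType k) (h : T -> U).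

Definition free_lift_fun (x : {malg k[T]}) : U := \sum_(t <- msupp x) x@_t *: h t.

Lemma free_lift_funE (d : {fset T}) x : (msupp x `<=` d)%fset ->
  free_lift_fun x = \sum_(t <- d) x@_t *: h t.
Proof.
move=> le; rewrite /free_lift_fun; apply: big_fset_incl => // t _.
by move=> /mcoeff_outdom ->; rewrite scale0r.
Qed.

Fact free_lift_is_linear : linear (free_lift_fun : free -> U).
Proof.
move=> a x y; pose d := (msupp x `|` msupp y `|` msupp (a *: x + y))%fset.
rewrite !(@free_lift_funE d) /d.
- rewrite scaler_sumr -big_split /=; apply: eq_bigr => t _.
  by rewrite mcoeffD mcoeffZ scalerDl scalerA.
- by rewrite -fsetUA fsetUCA fsubsetUl.
- by rewrite -fsetUA fsubsetUl.
- by rewrite fsubsetUr.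
Qed.
Definition free_lift : {linear free -> U} := mklin free_lift_is_linear.

Lemma free_liftE t : free_lift (fgen t) = h t.
Proof.
rewrite /= (@free_lift_funE [fset t]%fset) ?msuppU_le // big_seq_fset1.
by rewrite mcoeffUU scale1r.
Qed.

Lemma free_lift_lin a t u v : h t = a *: h u + h v ->
  free_lift (fgen t - (a *: fgen u + fgen v)) = 0.
Proof. by move=> e; rewrite linearB linearP !free_liftE e subrr. Qed.

Lemma free_lift_sub t u : h t = h u -> free_lift (fgen t - fgen u) = 0.
Proof. by move=> e; rewrite linearB !free_liftE e subrr. Qed.
End Lift.

Lemma free_ext U (f g : {linear free -> U}) :
  (forall t, f (fgen t) = g (fgen t)) -> f =1 g.
Proof.
move=> h x; rewrite [x]monalgE !linear_sum; apply: eq_bigr => t _.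
have -> : << x@_t *g t >> = x@_t *: fgen t.
  by apply/malgP => u; rewrite mcoeffZ !mcoeffU mulrnAr mulr1.
by rewrite !linearZ h.
Qed.
End Free.

End LinearAlgebra.

Global Opaque submod submod_val submod_in quot quotmk quot_lift.
Arguments fgen {k T} t.
Global Opaque free fgen free_lift.

Section Tensor.
Variable k : fieldType.

(* V (x) W is the free module on V * W modulo bilinearity. *)
Inductive tensor_rel (V W : lmodType k) : free k (V * W)%type -> Prop :=
| tensor_relPl a v v' w : tensor_rel
    (fgen (a *: v + v', w) - (a *: fgen (v, w) + fgen (v', w)))
| tensor_relPr a v w w' : tensor_rel
    (fgen (v, a *: w + w') - (a *: fgen (v, w) + fgen (v, w'))).

Definition tensor (V W : lmodType k) : lmodType k :=
  quot (span (@tensor_rel V W)).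

Section Universal.
Variables V W : lmodType k.
Definition tmk (v : V) (w : W) : tensor V W := quotmk _ (fgen (v, w)).

Lemma tmkPl a v v' w : tmk (a *: v + v') w = a *: tmk v w + tmk v' w.
Proof. by rewrite /tmk -linearP; apply/quotmk_eq/span_mem/tensor_relPl. Qed.
Lemma tmkPr a v w w' : tmk v (a *: w + w') = a *: tmk v w + tmk v w'.
Proof. by rewrite /tmk -linearP; apply/quotmk_eq/span_mem/tensor_relPr. Qed.

Section Lift.
Variables (U : lmodType k) (h : V -> W -> U).
Hypothesis hl : forall w, linear (h^~ w).
Hypothesis hr : forall v, linear (h v).

Fact tensor_lift_subproof x : x \in span (@tensor_rel V W) ->
  free_lift (fun vw : V * W => h vw.1 vw.2) x = 0.
Proof.
apply: span_ker => _ [a v v' w|a v w w']; apply: free_lift_lin.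
  exact: hl.
exact: hr.
Qed.
Definition tensor_lift : {linear tensor V W -> U} := quot_lift tensor_lift_subproof.

Lemma tensor_liftE v w : tensor_lift (tmk v w) = h v w.
Proof. by rewrite /tensor_lift quot_liftE free_liftE. Qed.
End Lift.

Lemma tensor_ext (U : lmodType k) (f g : {linear tensor V W -> U}) :
  (forall v w, f (tmk v w) = g (tmk v w)) -> f =1 g.
Proof.
move=> h; apply: quot_ext.
apply: (@free_ext k _ U (f \o quotmk (span (@tensor_rel V W)))
                     (g \o quotmk (span (@tensor_rel V W)))) => -[v w].
exact: h.
Qed.
End Universal.

Section Map.
Variables (U U' V V' : lmodType k) (f : {linear U -> U'}) (g : {linear V -> V'}).
Definition tensor_map : {linear tensor U V -> tensor U' V'}.
Proof.
apply: (@tensor_lift U V _ (fun u v => tmk (f u) (g v))).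
  by move=> v a x y; rewrite linearP tmkPl.
by move=> u a x y; rewrite linearP tmkPr.
Defined.

Lemma tensor_mapE u v : tensor_map (tmk u v) = tmk (f u) (g v).
Proof. exact: tensor_liftE. Qed.
End Map.

End Tensor.

Global Opaque tensor tmk tensor_lift tensor_map.

Record pmod (k : fieldType) (d : Order.disp_t) (J : porderType d) := Pmod {
  pobj :> J -> lmodType k;
  pmap : forall i j : J, (i <= j)%O -> {linear pobj i -> pobj j};
  pmap_id : forall i (h : (i <= i)%O) x, pmap h x = x;
  pmap_comp : forall i j l (hij : (i <= j)%O) (hjl : (j <= l)%O)
    (hil : (i <= l)%O) x, pmap hjl (pmap hij x) = pmap hil x }.

Record phom (k : fieldType) d (J : porderType d) (M N : pmod k J) := Phom {
  pfun :> forall i, {linear M i -> N i};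
  pfun_nat : forall i j (h : (i <= j)%O) x,
    pfun j (pmap M h x) = pmap N h (pfun i x) }.

Section Homs.
Context {k : fieldType} {d : Order.disp_t} {J : porderType d}.
Implicit Types L M N : pmod k J.

Definition pid M : phom M M := @Phom _ _ _ M M (fun=> idfun) (fun _ _ _ _ => erefl).

Definition pzero M N : phom M N.
Proof. by exists (fun=> \0) => i j h x /=; rewrite linear0. Defined.

Definition pcomp L M N (g : phom M N) (f : phom L M) : phom L N.
Proof. by exists (fun i => g i \o f i) => i j h x /=; rewrite !pfun_nat. Defined.

(* Kernels, images and quotients are computed pointwise. *)
Record psub M := Psub {
  psub_at :> forall i, submodClosed (M i);
  psub_stable : forall i j (h : (i <= j)%O) x,
    x \in psub_at i -> pmap M h x \in psub_at j }.

Section PSub.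
Variables (M : pmod k J) (S : psub M).

Fact psub_map_subproof i j (h : (i <= j)%O) : linear (fun x : submod (S i) =>
  submod_in (psub_stable h (submod_valP x)) : submod (S j)).
Proof.
by move=> a x y; apply: submod_val_inj; rewrite [RHS]linearP !submod_inK !linearP.
Qed.

Definition psub_pmod : pmod k J.
Proof.
exists (fun i => submod (S i)) (fun i j h => mklin (psub_map_subproof h)).
  by move=> i h x; apply: submod_val_inj; rewrite submod_inK pmap_id.
move=> i j l hij hjl hil x; apply: submod_val_inj.
by rewrite !submod_inK (pmap_comp _ _ hil).
Defined.

Definition pincl : phom psub_pmod M.
Proof. by exists (fun i => submod_val (S i)). Defined.

Fact pquot_map_subproof i j (h : (i <= j)%O) x :
  x \in S i -> (quotmk (S j) \o pmap M h) x = 0.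
Proof.
move=> hx; rewrite -(linear0 (quotmk (S j))); apply/quotmk_eq.
by rewrite subr0; apply: psub_stable.
Qed.

Definition pquot : pmod k J.
Proof.
exists (fun i => quot (S i)) (fun i j h => quot_lift (@pquot_map_subproof i j h)).
  by move=> i h q; case: (quotP q) => x ->; rewrite quot_liftE /= pmap_id.
move=> i j l hij hjl hil q; case: (quotP q) => x ->.
by rewrite !quot_liftE /= -(pmap_comp hij hjl hil).
Defined.

Definition pproj : phom M pquot.
Proof. by exists (fun i => quotmk (S i)) => i j h x; exact/esym/quot_liftE. Defined.
End PSub.

Lemma pquot_mapE M (S : psub M) i j (h : (i <= j)%O) x :
  pmap (pquot S) h (quotmk (S i) x) = quotmk (S j) (pmap M h x).
Proof. exact: quot_liftE. Qed.

Section PQuotHom.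
Variables (M M' : pmod k J) (f : phom M M') (S : psub M) (S' : psub M').
Hypothesis hf : forall i x, x \in S i -> f i x \in S' i.

Fact pquot_hom_subproof i x : x \in S i -> (quotmk (S' i) \o f i) x = 0.
Proof.
move=> hx; rewrite -(linear0 (quotmk (S' i))); apply/quotmk_eq.
by rewrite subr0; apply: hf.
Qed.

Definition pquot_hom : phom (pquot S) (pquot S').
Proof.
exists (fun i => quot_lift (@pquot_hom_subproof i)) => i j h t.
case: (quotP t) => x ->.
apply: (@etrans _ _ (quotmk (S' j) (f j (pmap M h x)))).
  by apply: (etrans (congr1 _ (pquot_mapE S h x))); apply: quot_liftE.
rewrite pfun_nat; apply: (etrans (esym (pquot_mapE S' h (f i x)))).
exact: (congr1 _ (esym (quot_liftE (@pquot_hom_subproof i) x))).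
Defined.

Lemma pquot_homE i x : pquot_hom i (quotmk (S i) x) = quotmk (S' i) (f i x).
Proof. exact: quot_liftE. Qed.
End PQuotHom.

Definition pker M N (f : phom M N) : psub M.
Proof.
exists (fun i => [the submodClosed (M i) of lker (f i)]) => i j h x /eqP hx.
by apply/eqP; rewrite pfun_nat hx linear0.
Defined.

Definition pimg M N (f : phom M N) : psub N.
Proof.
exists (fun i => [the submodClosed (N i) of limg (f i)]) => i j h _ /asboolP[x <-].
by apply/asboolP; exists (pmap M h x); rewrite pfun_nat.
Defined.

Definition ppreim M N (f : phom M N) (S : psub N) : psub M.
Proof.
exists (fun i => [the submodClosed (M i) of lpreim (f i) (S i)]) => i j h x hx.
by rewrite /lpreim unfold_in pfun_nat; apply: psub_stable.
Defined.

(* These are the epimorphisms of persistence modules, see [psurjP]. *)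
Definition psurj M N (f : phom M N) : Prop := forall i y, exists x, f i x = y.

Definition pinj M N (f : phom M N) : Prop := forall i, injective (f i).

Definition short_exact L M N (f : phom L M) (g : phom M N) : Prop :=
  [/\ pinj f, psurj g & forall i y, g i y = 0 <-> exists x, f i x = y].

Definition projective N : Prop := forall X Y (e : phom X Y) (f : phom N Y),
  psurj e -> exists g : phom N X, forall i x, e i (g i x) = f i x.

End Homs.

Section Colimit.
Context {k : fieldType} {d : Order.disp_t} {J : porderType d}.

(* The colimit of the restriction of D to the full subposet {j | S j}: the free
   module on the disjoint union of the D_j with S j, modulo linearity on each
   D_j and the identification of x with its images under the structure maps. *)
Section Def.
Variables (D : pmod k J) (S : pred J).
Definition colim_gen := {x : {j : J & D j} | S (tag x)}.
HB.instance Definition _ := Choice.copy colim_gen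
  {x : {j : J & (D j : choiceType)} | S (tag x)}.
Definition cgen j (hj : S j) (x : D j) : colim_gen :=
  exist (fun y : {j : J & D j} => S (tag y)) (Tagged (fun j => D j) x) hj.

Inductive colim_rel : free k colim_gen -> Prop :=
| colim_relP j (hj : S j) a x y : colim_rel
    (fgen (cgen hj (a *: x + y)) - (a *: fgen (cgen hj x) + fgen (cgen hj y)))
| colim_relM i j (hi : S i) (hj : S j) (le : (i <= j)%O) x : colim_rel
    (fgen (cgen hj (pmap D le x)) - fgen (cgen hi x)).

Definition colim : lmodType k := quot (span colim_rel).

Fact colim_in_subproof j (hj : S j) :
  linear (fun x => quotmk (span colim_rel) (fgen (cgen hj x)) : colim).
Proof. by move=> a x y; rewrite -linearP; apply/quotmk_eq/span_mem/colim_relP. Qed.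
Definition colim_in j (hj : S j) : {linear D j -> colim} :=
  mklin (colim_in_subproof hj).

Lemma colim_in_compat i j (hi : S i) (hj : S j) (le : (i <= j)%O) x :
  colim_in hj (pmap D le x) = colim_in hi x.
Proof. exact/quotmk_eq/span_mem/colim_relM. Qed.

Section Lift.
Variables (U : lmodType k) (h : forall j, S j -> {linear D j -> U}).
Hypothesis hh : forall i j (hi : S i) (hj : S j) (le : (i <= j)%O) x,
  h hj (pmap D le x) = h hi x.

Fact colim_lift_subproof x : x \in span colim_rel ->
  free_lift (fun y : colim_gen => h (proj2_sig y) (tagged (proj1_sig y))) x = 0.
Proof.
apply: span_ker => _ [j hj a u v|i j hi hj le u].
  by apply: free_lift_lin; apply: (linearP (@h j hj)).
by apply: free_lift_sub; apply: hh.
Qed.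
Definition colim_lift : {linear colim -> U} := quot_lift colim_lift_subproof.

Lemma colim_liftE j (hj : S j) x : colim_lift (colim_in hj x) = h hj x.
Proof.
by rewrite /colim_lift quot_liftE free_liftE.
Qed.
End Lift.

Lemma colim_ext (U : lmodType k) (f g : {linear colim -> U}) :
  (forall j (hj : S j) x, f (colim_in hj x) = g (colim_in hj x)) -> f =1 g.
Proof.
move=> h; apply: quot_ext.
apply: (@free_ext _ _ U (f \o quotmk (span colim_rel))
                        (g \o quotmk (span colim_rel))) => -[[j x] hj].
exact: h.
Qed.
End Def.
End Colimit.

Global Opaque colim colim_in colim_lift.

Section ColimitMap.
Context {k : fieldType} {d : Order.disp_t} {J : porderType d}.

Section Map.
Variables (D D' : pmod k J) (f : phom D D') (S S' : pred J).
Hypothesis sub : forall j, S j -> S' j.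

Definition colim_map : {linear colim D S -> colim D' S'}.
Proof.
apply: (@colim_lift _ _ _ D S (colim D' S')
  (fun j hj => colim_in D' (sub hj) \o f j)).
move=> i j hi hj le x.
change (colim_in D' (sub hj) (f j (pmap D le x)) = colim_in D' (sub hi) (f i x)).
by rewrite pfun_nat; apply: colim_in_compat.
Defined.

Lemma colim_mapE j (hj : S j) x :
  colim_map (colim_in D hj x) = colim_in D' (sub hj) (f j x).
Proof. exact: colim_liftE. Qed.
End Map.

Lemma colim_map_id (D : pmod k J) (f : phom D D) (S : pred J)
    (sub : forall j, S j -> S j) :
  (forall j x, f j x = x) -> colim_map f sub =1 id.
Proof.
move=> hf; apply: (@colim_ext _ _ _ D S _ _ idfun) => j hj x.
rewrite colim_mapE hf -[RHS]/(colim_in D hj x).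
by congr (colim_in _ _ x); apply: bool_irrelevance.
Qed.

Lemma colim_map_comp (D D' D'' : pmod k J) (f' : phom D' D'') (f : phom D D')
    (h : phom D D'') (S S' S'' : pred J) (sub' : forall j, S' j -> S'' j)
    (sub : forall j, S j -> S' j) (sub'' : forall j, S j -> S'' j) :
  (forall j x, f' j (f j x) = h j x) ->
  forall t, colim_map f' sub' (colim_map f sub t) = colim_map h sub'' t.
Proof.
move=> hf; apply: (@colim_ext _ _ _ D S _ (colim_map f' sub' \o colim_map f sub)).
move=> j hj x.
rewrite -[LHS]/(colim_map f' sub' (colim_map f sub (colim_in D hj x))).
rewrite !colim_mapE hf.
by congr (colim_in _ _ _); apply: bool_irrelevance.
Qed.

End ColimitMap.

Global Opaque colim_map.

Section PhiTensor.
Context {k : fieldType} {d : Order.disp_t} {P : porderType d}.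

Lemma tensor_map_id (U V : lmodType k) (f : {linear U -> U}) (g : {linear V -> V}) :
  f =1 id -> g =1 id -> tensor_map f g =1 id.
Proof.
move=> hf hg; apply: (@tensor_ext k U V _ _ idfun) => u v.
by rewrite tensor_mapE hf hg.
Qed.

Lemma tensor_map_comp (U U' U'' V V' V'' : lmodType k)
    (f' : {linear U' -> U''}) (f : {linear U -> U'}) (h : {linear U -> U''})
    (g' : {linear V' -> V''}) (g : {linear V -> V'}) (l : {linear V -> V''}) :
  (forall u, f' (f u) = h u) -> (forall v, g' (g v) = l v) ->
  forall t, tensor_map f' g' (tensor_map f g t) = tensor_map h l t.
Proof.
move=> hf hg; apply: (@tensor_ext k U V _ (tensor_map f' g' \o tensor_map f g)).
move=> u v; rewrite -[LHS]/(tensor_map f' g' (tensor_map f g (tmk u v))).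
by rewrite !tensor_mapE hf hg.
Qed.

Fact le_pair1 (x y : P *p P) : (x <= y)%O -> (x.1 <= y.1)%O.
Proof. by rewrite leEprod => /andP[]. Qed.
Fact le_pair2 (x y : P *p P) : (x <= y)%O -> (x.2 <= y.2)%O.
Proof. by rewrite leEprod => /andP[]. Qed.

(* The diagram (a, b) |-> M_a (x) N_b on P x P with the product order. *)
Definition ptensor_diag (M N : pmod k P) : pmod k (P *p P).
Proof.
exists (fun x => tensor (M x.1) (N x.2))
       (fun x y h => tensor_map (pmap M (le_pair1 h)) (pmap N (le_pair2 h))).
- by move=> x h; apply: tensor_map_id => t; apply: pmap_id.
- by move=> x y z hxy hyz hxz; apply: tensor_map_comp => t; apply: pmap_comp.
Defined.

Definition ptensor_diag_map (M M' N N' : pmod k P) (f : phom M M') (g : phom N N') :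
  phom (ptensor_diag M N) (ptensor_diag M' N').
Proof.
exists (fun x => tensor_map (f x.1) (g x.2)) => x y h t.
rewrite [LHS](@tensor_map_comp _ _ _ _ _ _ _ _ (f y.1 \o pmap M (le_pair1 h))
                                     _ _ (g y.2 \o pmap N (le_pair2 h))) //.
by apply/esym/tensor_map_comp => u; rewrite /= pfun_nat.
Defined.

Variable phi : P *p P -> P.

Definition below (p : P) : pred (P *p P) := fun x => (phi x <= p)%O.

Definition ptensor (M N : pmod k P) : pmod k P.
Proof.
exists (fun p => colim (ptensor_diag M N) (below p))
       (fun p q h => colim_map (pid (ptensor_diag M N))
                       (fun x (hx : below p x) => le_trans hx h)).
- by move=> p h t; apply: colim_map_id.
- by move=> p q r hpq hqr hpr t; apply: colim_map_comp.
Defined.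

Definition ptensor_map (M M' N N' : pmod k P) (f : phom M M') (g : phom N N') :
  phom (ptensor M N) (ptensor M' N').
Proof.
exists (fun p => colim_map (ptensor_diag_map f g) (fun x (hx : below p x) => hx)).
move=> p q h t.
pose s (x : P *p P) (hx : below p x) : below q x := le_trans hx h.
apply: (@etrans _ _ (colim_map (ptensor_diag_map f g) s t)).
  exact: colim_map_comp.
exact/esym/colim_map_comp.
Defined.

Lemma ptensor_ext (M N : pmod k P) p (U : lmodType k)
    (f g : {linear ptensor M N p -> U}) :
  (forall (x : P *p P) (hx : below p x) u v,
    f (colim_in (ptensor_diag M N) hx (tmk u v)) =
    g (colim_in (ptensor_diag M N) hx (tmk u v))) -> f =1 g.
Proof.
move=> h; apply: colim_ext => x hx t.
apply: (@tensor_ext _ _ _ _ (f \o colim_in (ptensor_diag M N) hx)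
                           (g \o colim_in (ptensor_diag M N) hx)) => u v.
exact: h.
Qed.

Lemma ptensor_mapE (M M' N N' : pmod k P) (f : phom M M') (g : phom N N')
    p (x : P *p P) (hx : below p x) u v :
  ptensor_map f g p (colim_in (ptensor_diag M N) hx (tmk u v)) =
  colim_in (ptensor_diag M' N') hx (tmk (f x.1 u) (g x.2 v)).
Proof.
rewrite [LHS]colim_mapE; congr (colim_in _ _ _); exact: tensor_mapE.
Qed.

Lemma ptensor_map_comp (M M' M'' N N' N'' : pmod k P)
    (f' : phom M' M'') (f : phom M M') (g' : phom N' N'') (g : phom N N') p t :
  ptensor_map f' g' p (ptensor_map f g p t) =
  ptensor_map (pcomp f' f) (pcomp g' g) p t.
Proof.
move: t; apply: (@ptensor_ext _ _ p _ (ptensor_map f' g' p \o ptensor_map f g p)).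
move=> x hx u v.
rewrite -[LHS]/(ptensor_map f' g' p (ptensor_map f g p
  (colim_in (ptensor_diag M N) hx (tmk u v)))).
by rewrite !ptensor_mapE.
Qed.

Lemma eq_ptensor_map (M M' N N' : pmod k P) (f f' : phom M M') (g g' : phom N N') :
  (forall p x, f p x = f' p x) -> (forall p x, g p x = g' p x) ->
  forall p t, ptensor_map f g p t = ptensor_map f' g' p t.
Proof.
move=> hf hg p; 
apply: (@ptensor_ext M N p _ (ptensor_map f g p) (ptensor_map f' g' p)) => x hx u v.
by rewrite [LHS]ptensor_mapE [RHS]ptensor_mapE (hf x.1 u) (hg x.2 v).
Qed.

Lemma ptensor_map0l (M M' N N' : pmod k P) (f : phom M M') (g : phom N N') :
  (forall p x, f p x = 0) -> forall p t, ptensor_map f g p t = 0.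
Proof.
move=> hf p; apply: (@ptensor_ext _ _ p _ _ \0) => x hx u v.
rewrite ptensor_mapE hf.
have -> : tmk 0 (g x.2 v) = 0 :> tensor (M' x.1) (N' x.2).
  have := tmkPl (-1) (0 : M' x.1) 0 (g x.2 v).
  by rewrite scaleN1r oppr0 addr0 scaleN1r addNr.
by rewrite linear0.
Qed.

End PhiTensor.

Section ChainComplexes.
Context {k : fieldType} {d : Order.disp_t} {P : porderType d}.

(* Chain complexes graded by the integers; a complex concentrated in
   nonnegative degrees is one whose terms of negative degree vanish.  The
   family [cd] is indexed by arbitrary pairs of degrees to avoid transports:
   [cd_shape] says that only the differentials [cd i (i - 1)] are relevant. *)
Record cplx := Cplx {
  cobj :> int -> pmod k P;
  cd : forall i j, phom (cobj i) (cobj j);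
  cd_shape : forall i j, i != j + 1 -> forall p x, cd i j p x = 0;
  cd_cd : forall i j l p x, cd j l p (cd i j p x) = 0 }.

Record cmap (K K' : cplx) := Cmap {
  cfun :> forall i, phom (K i) (K' i);
  cfun_d : forall i j p x, cfun j p (cd K i j p x) = cd K' i j p (cfun i p x) }.

Definition cycles (n : int) (K : cplx) : psub (K n) := pker (cd K n (n - 1)).
Definition boundaries (n : int) (K : cplx) : psub (K n) := pimg (cd K (n + 1) n).

Definition homology (n : int) (K : cplx) : pmod k P :=
  pquot (ppreim (pincl (cycles n K)) (boundaries n K)).

Section HomologyMap.
Variables (K K' : cplx) (f : cmap K K') (n : int).

Fact cycles_map_subproof p (x : K n p) :
  x \in cycles n K p -> f n p x \in cycles n K' p.
Proof. by move=> /eqP hx; apply/eqP; rewrite -cfun_d hx linear0. Qed.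

Fact cycles_map_linear p : linear (fun x : submod (cycles n K p) =>
  submod_in (cycles_map_subproof (submod_valP x)) : submod (cycles n K' p)).
Proof.
by move=> a x y; apply: submod_val_inj; rewrite [RHS]linearP !submod_inK !linearP.
Qed.

Definition cycles_map : phom (psub_pmod (cycles n K)) (psub_pmod (cycles n K')).
Proof.
exists (fun p => mklin (@cycles_map_linear p)) => p q h x.
by apply: submod_val_inj; rewrite !submod_inK pfun_nat.
Defined.

Fact homology_map_subproof p x :
  x \in ppreim (pincl (cycles n K)) (boundaries n K) p ->
  cycles_map p x \in ppreim (pincl (cycles n K')) (boundaries n K') p.
Proof.
move=> /asboolP[y hy]; apply/asboolP; exists (f (n + 1) p y).
by rewrite -cfun_d hy.
Qed.

Definition homology_map : phom (homology n K) (homology n K') :=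
  pquot_hom homology_map_subproof.
End HomologyMap.

Variable phi : P *p P -> P.

Definition ctensor (K : cplx) (A : pmod k P) : cplx.
Proof.
exists (fun i => ptensor phi (K i) A) (fun i j => ptensor_map phi (cd K i j) (pid A)).
  by move=> i j ij; apply: ptensor_map0l; apply: cd_shape.
move=> i j l p t; rewrite ptensor_map_comp; apply: ptensor_map0l => q x.
exact: cd_cd.
Defined.

Definition ctensor_map (K K' : cplx) (A A' : pmod k P) (f : cmap K K')
  (g : phom A A') : cmap (ctensor K A) (ctensor K' A').
Proof.
exists (fun i => ptensor_map phi (f i) g) => i j p x.
rewrite /= !ptensor_map_comp; apply: eq_ptensor_map => q y //=.
exact: cfun_d.
Defined.

(* Q_1 -> Q_0 -> M -> 0 continued to the left; the terms of negative degree are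
   zero.  Existence is [presolution_exists] below. *)
Record presolution (M : pmod k P) := Presolution {
  rcplx :> cplx;
  raug : phom (rcplx 0) M;
  rneg : forall i, i < 0 -> forall p (x : rcplx i p), x = 0;
  rproj : forall i, projective (rcplx i);
  raug_surj : psurj raug;
  raug_exact : forall p x, raug p x = 0 <-> exists y, cd rcplx 1 0 p y = x;
  rexact : forall i, 0 < i -> forall p x,
    cd rcplx i (i - 1) p x = 0 <-> exists y, cd rcplx (i + 1) i p y = x }.

Definition lifts (M M' : pmod k P) (Q : presolution M) (Q' : presolution M')
    (f : phom M M') (F : cmap Q Q') : Prop :=
  forall p x, raug Q' p (F 0 p x) = f p (raug Q p x).

(* Tor is computed from an arbitrary choice Q of projective resolutions.  Its
   value on a morphism f of the first variable is induced by a chain map F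
   between the chosen resolutions that lifts f. *)
Section Tor.
Variable Q : forall M : pmod k P, presolution M.

Definition Tor (i : int) (M A : pmod k P) : pmod k P :=
  homology i (ctensor (Q M) A).

Definition Tor_map (i : int) (M M' A A' : pmod k P) (F : cmap (Q M) (Q M'))
    (g : phom A A') : phom (Tor i M A) (Tor i M' A') :=
  homology_map (ctensor_map F g) i.
End Tor.

End ChainComplexes.

Arguments cplx k {d} P.

Section EnoughProjectives.
Context {k : fieldType} {d : Order.disp_t} {P : porderType d}.

Section Cover.
Variable M : pmod k P.

Let gens (p : P) : choiceType := colim_gen M (fun q => (q <= p)%O).

Let cov_gen p q (h : (q <= p)%O) (x : M q) : free k (gens p) :=
  fgen (cgen (S := fun q => (q <= p)%O) h x).

Let cov_map p p' (h : (p <= p')%O) : {linear free k (gens p) -> free k (gens p')} :=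
  free_lift (fun y : gens p =>
    cov_gen (le_trans (proj2_sig y : (tag (proj1_sig y) <= p)%O) h)
            (tagged (proj1_sig y))).

Let cov_mapE p p' (h : (p <= p')%O) q (hq : (q <= p)%O) (hq' : (q <= p')%O) x :
  cov_map h (cov_gen hq x) = cov_gen hq' x.
Proof.
rewrite /cov_map free_liftE /cov_gen; congr (fgen (cgen _ x)).
exact: bool_irrelevance.
Qed.

(* The direct sum, over q in P and x in M_q, of the free modules k[U_q]. *)
Definition cover : pmod k P.
Proof.
exists (fun p => free k (gens p)) cov_map.
- move=> p h; apply: (@free_ext _ _ _ _ idfun) => -[[q x] hq].
  exact: (cov_mapE h hq hq x).
- move=> p1 p2 p3 h12 h23 h13.
  apply: (@free_ext _ _ _ (cov_map h23 \o cov_map h12)) => -[[q x] hq].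
  have hq2 := le_trans hq h12; have hq3 := le_trans hq2 h23.
  apply: (etrans (congr1 (cov_map h23) (cov_mapE h12 hq hq2 x))).
  by rewrite (cov_mapE _ _ hq3); apply/esym/(cov_mapE _ hq).
Defined.

Let caug p : {linear free k (gens p) -> M p} := free_lift (fun y : gens p =>
  pmap M (proj2_sig y : (tag (proj1_sig y) <= p)%O) (tagged (proj1_sig y))).

Let caugE p q (hq : (q <= p)%O) (x : M q) : caug p (cov_gen hq x) = pmap M hq x.
Proof. exact: free_liftE. Qed.

Definition cover_aug : phom cover M.
Proof.
exists caug => p p' h.
apply: (@free_ext _ _ _ (caug p' \o cov_map h) (pmap M h \o caug p)) => -[[q x] hq].
apply: (etrans (congr1 (caug p') (cov_mapE h hq (le_trans hq h) x))).
rewrite caugE; apply: (etrans _ (congr1 (pmap M h) (esym (caugE hq x)))).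
exact/esym/pmap_comp.
Defined.

Lemma cover_aug_surj : psurj cover_aug.
Proof.
move=> p x; exists (cov_gen (lexx p) x); apply: (etrans (caugE _ _)).
exact: pmap_id.
Qed.

Lemma cover_projective : projective cover.
Proof.
move=> X Y e f he.
pose z q (x : M q) := cid (he q (f q (cov_gen (lexx q) x))).
pose g p : {linear cover p -> X p} := free_lift (fun y : gens p =>
  pmap X (proj2_sig y : (tag (proj1_sig y) <= p)%O) (projT1 (z _ (tagged (proj1_sig y))))).
have gE p q (hq : (q <= p)%O) x : g p (cov_gen hq x) = pmap X hq (projT1 (z q x)).
  exact: free_liftE.
have gnat i j (h : (i <= j)%O) x : g j (pmap cover h x) = pmap X h (g i x).
  move: x; apply: (@free_ext _ _ _ (g j \o cov_map h) (pmap X h \o g i)).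
  move=> -[[q x] hq].
  apply: (etrans (congr1 (g j) (cov_mapE h hq (le_trans hq h) x))).
  rewrite gE; apply: (etrans _ (congr1 (pmap X h) (esym (gE i q hq x)))).
  exact/esym/pmap_comp.
exists (Phom gnat) => p.
apply: (@free_ext _ _ _ (e p \o g p) (f p)) => -[[q x] hq].
apply: (etrans (congr1 (e p) (gE p q hq x))).
rewrite pfun_nat (projT2 (z q x)) -pfun_nat; congr (f p _).
exact: (cov_mapE hq (lexx q) hq).
Qed.
End Cover.

Definition pnull (M : pmod k P) : pmod k P := psub_pmod (pker (pid M)).

Lemma pnull0 M p (x : pnull M p) : x = 0.
Proof.
apply: submod_val_inj; rewrite linear0; apply/eqP.
exact: (submod_valP x).
Qed.

Lemma pnull_projective M : projective (pnull M).
Proof.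
move=> X Y e f _; exists (pzero _ _) => i x.
by rewrite (pnull0 x) !linear0.
Qed.

Section FreeResolution.
Variable M : pmod k P.

Let step (N : pmod k P) : pmod k P := psub_pmod (pker (cover_aug N)).
Let syz (i : nat) : pmod k P := iter i step M.
Let X (i : nat) : pmod k P := cover (syz i).
Let delta (i : nat) : phom (X i.+1) (X i) :=
  pcomp (pincl (pker (cover_aug (syz i)))) (cover_aug (syz i.+1)).

Let deltaE i p x : cover_aug (syz i) p x = 0 <-> exists y, delta i p y = x.
Proof.
split=> [hx|[y <-]]; last first.
  exact/eqP/(@submod_valP _ _ (pker (cover_aug (syz i)) p) (cover_aug (syz i.+1) p y)).
have hx' : x \in pker (cover_aug (syz i)) p by apply/eqP.
have [y hy] := cover_aug_surj (submod_in hx' : syz i.+1 p).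
by exists y; rewrite -[LHS]/(submod_val _ (cover_aug (syz i.+1) p y)) hy submod_inK.
Qed.

Let delta0 i p x : delta i p x = 0 <-> cover_aug (syz i.+1) p x = 0.
Proof.
rewrite -[delta i p x]/(submod_val _ (cover_aug (syz i.+1) p x)).
split=> [h|->]; last exact: linear0.
by apply: submod_val_inj; rewrite h linear0.
Qed.

Let dN (i j : nat) : phom (X i) (X j) :=
  match i =P j.+1 with
  | ReflectT e => eq_rect_r (fun m => phom (X m) (X j)) (delta j) e
  | ReflectF _ => pzero _ _
  end.

Let dNS j : dN j.+1 j = delta j.
Proof. by rewrite /dN; case: eqP => // e; rewrite (eq_axiomK e). Qed.

Let dNN i j : i != j.+1 -> dN i j = pzero _ _.
Proof. by rewrite /dN; case: eqP. Qed.

Let Z (i : int) : pmod k P := if i is Posz n then X n else pnull M.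
Let dZ (i j : int) : phom (Z i) (Z j) :=
  match i, j with
  | Posz m, Posz n => dN m n
  | _, _ => pzero _ _
  end.

Let dZ_shape i j : i != j + 1 -> forall p x, dZ i j p x = 0.
Proof.
case: i j => [m|m] [n|n] //= ne p x.
by rewrite dNN //; apply: contraNneq ne => ->; rewrite -addn1 PoszD.
Qed.

Let dZ_dZ i j l p x : dZ j l p (dZ i j p x) = 0.
Proof.
case: i j l x => [m|m] [n|n] [r|r] //= x; rewrite ?linear0 //.
have [e|ne] := eqVneq m n.+1; last by rewrite (dNN ne) linear0.
have [f|ne] := eqVneq n r.+1; last by rewrite (dNN ne).
subst n; subst m; rewrite !dNS; apply/delta0/deltaE; by exists x.
Qed.

Let Q : cplx k P := Cplx dZ_shape dZ_dZ.

Lemma presolution_exists : inhabited (presolution M).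
Proof.
have e1 : (1 : int) = Posz 1 by [].
constructor; apply: (@Presolution _ _ _ M Q (cover_aug M)).
- by case=> // n _ p x; apply: (@pnull0 M p x).
- case=> n; [exact: cover_projective | exact: pnull_projective].
- exact: cover_aug_surj.
- by move=> p x; rewrite -[cd Q 1 0]/(dN 1 0) dNS; apply: (deltaE (i := 0)).
- case=> // -[//|n] _ p x.
  have -> : n.+1%:Z - 1 = n by rewrite intS addrC addKr.
  have -> : n.+1%:Z + 1 = n.+2 by rewrite addrC -intS.
  rewrite -[cd Q n.+1 n]/(dN n.+1 n) -[cd Q n.+2 n.+1]/(dN n.+2 n.+1) !dNS.
  exact: (iff_trans (delta0 x) (deltaE x)).
Qed.
End FreeResolution.

Lemma projective_factor (N X Y L : pmod k P) (g : phom N Y) (u : phom X Y)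
    (v : phom Y L) :
  projective N -> (forall p y, v p y = 0 -> exists x, u p x = y) ->
  (forall p x, v p (g p x) = 0) ->
  exists h : phom N X, forall p x, u p (h p x) = g p x.
Proof.
move=> pN ex vg.
have memg p x : g p x \in pimg u p by apply/asboolP/ex/vg.
have memu p x : u p x \in pimg u p by apply/asboolP; exists x.
have ling p : linear (fun x => submod_in (memg p x)).
  by move=> a x y; apply: submod_val_inj; rewrite [RHS]linearP !submod_inK linearP.
have linu p : linear (fun x => submod_in (memu p x)).
  by move=> a x y; apply: submod_val_inj; rewrite [RHS]linearP !submod_inK linearP.
have natg p q (h : (p <= q)%O) x : mklin (ling q) (pmap N h x) =
    pmap (psub_pmod (pimg u)) h (mklin (ling p) x).
  by apply: submod_val_inj; rewrite !submod_inK pfun_nat.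
have natu p q (h : (p <= q)%O) x : mklin (linu q) (pmap X h x) =
    pmap (psub_pmod (pimg u)) h (mklin (linu p) x).
  by apply: submod_val_inj; rewrite !submod_inK pfun_nat.
pose u' := @Phom _ _ _ X (psub_pmod (pimg u)) (fun p => mklin (linu p)) natu.
pose g' := @Phom _ _ _ N (psub_pmod (pimg u)) (fun p => mklin (ling p)) natg.
have su : psurj u'.
  move=> p y; have /asboolP[x hx] := submod_valP y; exists x.
  by apply: submod_val_inj; rewrite submod_inK.
have [h hh] := pN _ _ u' g' su.
exists h => p x; have := congr1 (submod_val (pimg u p)) (hh p x).
by rewrite !submod_inK.
Qed.
Lemma rexactS (M : pmod k P) (Q : presolution M) (j : nat) p (x : Q j.+1 p) :
  cd Q j.+1 j p x = 0 <-> exists y, cd Q j.+2 j.+1 p y = x.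
Proof.
have := @rexact _ _ _ M Q j.+1%:Z isT p x.
have -> : j.+1%:Z - 1 = j by rewrite intS addrC addKr.
by have -> : j.+1%:Z + 1 = j.+2 by rewrite addrC -intS.
Qed.

(* The comparison theorem: the chain maps over which naturality is quantified
   below exist. *)
Section Lifting.
Variables (M M' : pmod k P) (f : phom M M').
Variables (Q : presolution M) (Q' : presolution M').

Let inv (i : nat) : phom (Q i) (Q' i) -> Prop :=
  match i with
  | 0 => fun F => forall p x, raug Q p x = 0 -> raug Q' p (F p x) = 0
  | j.+1 => fun F => forall p x, cd Q j.+1 j p x = 0 -> cd Q' j.+1 j p (F p x) = 0
  end.

Let stepP (i : nat) (F : phom (Q i) (Q' i)) : inv F ->
  exists F' : phom (Q i.+1) (Q' i.+1), inv F' /\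
    forall p x, cd Q' i.+1 i p (F' p x) = F p (cd Q i.+1 i p x).
Proof.
move=> hF.
suff [F' hF'] : exists F' : phom (Q i.+1) (Q' i.+1),
    forall p x, cd Q' i.+1 i p (F' p x) = F p (cd Q i.+1 i p x).
  by exists F'; split=> // p x hx; rewrite hF' hx linear0.
case: i F hF => [|i] F hF.
- apply: (projective_factor (g := pcomp F (cd Q 1 0)) (v := raug Q')).
  + exact: rproj.
  + by move=> p y /raug_exact.
  + by move=> p x; apply: hF; apply/raug_exact; exists x.
- apply: (projective_factor (g := pcomp F (cd Q i.+2 i.+1)) (v := cd Q' i.+1 i)).
  + exact: rproj.
  + by move=> p y /rexactS.
  + by move=> p x; apply: hF; apply: cd_cd.
Qed.

Lemma lifts_exists : exists F : cmap Q Q', lifts f F.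
Proof.
have [F0 hF0] : exists F0 : phom (Q 0) (Q' 0),
    forall p x, raug Q' p (F0 p x) = f p (raug Q p x).
  exact: (@rproj _ _ _ _ Q 0 _ _ (raug Q') (pcomp f (raug Q)) (@raug_surj _ _ _ _ Q')).
have inv0 : @inv 0 F0 by move=> p x hx; rewrite hF0 hx linear0.
pose T i := {F : phom (Q (Posz i)) (Q' (Posz i)) | inv F}.
pose next i (s : T i) : T i.+1 :=
  let w := cid (stepP (proj2_sig s)) in exist _ (projT1 w) (projT2 w).1.
pose Fs (i : nat) : T i := nat_rect T (exist _ F0 inv0) next i.
have FsS (i : nat) p x : cd Q' i.+1 i p (proj1_sig (Fs i.+1) p x) =
    proj1_sig (Fs i) p (cd Q i.+1 i p x).
  exact: (projT2 (cid (stepP (proj2_sig (Fs i))))).2.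
pose Fz (i : int) : phom (Q i) (Q' i) :=
  match i with Posz n => proj1_sig (Fs n) | Negz n => pzero _ _ end.
have Fz_d i j p x : Fz j p (cd Q i j p x) = cd Q' i j p (Fz i p x).
  have [e|ne] := eqVneq i (j + 1); last by rewrite !cd_shape // linear0.
  case: j e => [n|n] e; last by rewrite [RHS]rneg.
  have e' : i = n.+1 by rewrite e addrC -intS.
  by move: x; rewrite e' => x; rewrite FsS.
by exists (Cmap Fz_d).
Qed.
End Lifting.

End EnoughProjectives.

Section Kunneth.
Context {k : fieldType} {d : Order.disp_t} {P : porderType d}.
Variables (phi : P *p P -> P) (Q : forall M : pmod k P, presolution M) (n : int).

Definition proj_cplx (K : cplx k P) : Prop :=
  (forall i, projective (K i)) /\
  (forall i, projective (psub_pmod (boundaries i K))).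

Definition kunneth_left_type := forall K, proj_cplx K -> forall A : pmod k P,
  phom (ptensor phi (homology n K) A) (homology n (ctensor phi K A)).

Definition kunneth_right_type := forall K, proj_cplx K -> forall A : pmod k P,
  phom (homology n (ctensor phi K A)) (Tor phi Q 1 (homology (n - 1) K) A).

(* Naturality is required with respect to both K and A. *)
Definition left_natural (alpha : kunneth_left_type) : Prop :=
  forall K hK K' hK' A A' (f : cmap K K') (g : phom A A') p x,
  alpha K' hK' A' p (ptensor_map phi (homology_map f n) g p x) =
  homology_map (ctensor_map phi f g) n p (alpha K hK A p x).

Definition right_natural (beta : kunneth_right_type) : Prop :=
  forall K hK K' hK' A A' (f : cmap K K') (g : phom A A')
    (F : cmap (Q (homology (n - 1) K)) (Q (homology (n - 1) K'))),
  lifts (homology_map f (n - 1)) F -> forall p x,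
  beta K' hK' A' p (homology_map (ctensor_map phi f g) n p x) =
  Tor_map phi 1 F g p (beta K hK A p x).

Definition kunneth_sequence (alpha : kunneth_left_type)
    (beta : kunneth_right_type) : Prop :=
  [/\ forall K hK A, short_exact (alpha K hK A) (beta K hK A),
      left_natural alpha & right_natural beta].

(* Candidates for a choice of sections of the right-hand maps, A being fixed. *)
Definition splitting_type (A : pmod k P) := forall K, proj_cplx K ->
  phom (Tor phi Q 1 (homology (n - 1) K) A) (homology n (ctensor phi K A)).

Definition splitting_natural A (s : splitting_type A) : Prop :=
  forall K hK K' hK' (f : cmap K K')
    (F : cmap (Q (homology (n - 1) K)) (Q (homology (n - 1) K'))),
  lifts (homology_map f (n - 1)) F -> forall p z,
  s K' hK' p (Tor_map phi 1 F (pid A) p z) =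
  homology_map (ctensor_map phi f (pid A)) n p (s K hK p z).

End Kunneth.

(* Main.v *)
From Pilot Require Import Defs.
From mathcomp Require Import all_boot all_order ssralg ssrnum ssrint.
From mathcomp Require Import boolp.
Import Pilot.Defs.

Set Implicit Arguments.
Unset Strict Implicit.
Unset Printing Implicit Defensive.
Import Order.TTheory GRing.Theory Num.Theory.
Local Open Scope ring_scope.

(** The sequence exists and splits because the projectivity of the boundaries
makes K as simple as a complex of projectives can be.  Write Z_n, B_n for the
cycles and boundaries of K.  Since B_(n-1) is projective, the surjection
K_n -> B_(n-1) splits, so Z_n is a direct summand of K_n; the projectivity of B
enters through this retraction of K_n onto Z_n ([cycles_retract]).  In particular
Z_n is projective, and 0 -> B_n -> Z_n is a projective resolution of H_n(K).

The left-hand map sends [z] (x) a to [z (x) a]; it descends from cycles to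
homology because the tensor product is right exact ([ptensor_factor]), and it is
injective because the retraction onto Z_n yields a left inverse.  The right-hand
map compares K with the chosen resolution R of H_(n-1)(K): lift
Z_(n-1) -> H_(n-1)(K) to G0 : Z_(n-1) -> R_0, then the boundary map
K_n -> Z_(n-1) to G1 : K_n -> R_1, and apply G1 (x) A to cycles of K (x) A.  Any
two such lifts are homotopic on the cycles of K (x) A, which gives naturality
([homotopy_tens], [connecting_natural]).  Conversely, R_0 -> H_(n-1)(K) lifts to
S0 : R_0 -> Z_(n-1), and R_1 -> Z_(n-1) to S1 : R_1 -> K_n; correcting S1 by the
retraction onto Z_n makes it vanish on the image of R_2, so that S1 (x) A induces
a map on Tor.  It is a section since (G0 S0, G1 S1) is homotopic to the identity,
and S1 G1 - 1 differs from a map into Z_n by a map that factors through the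
boundary map, so
the kernel of the right-hand map comes from Z_n (x) A ([connecting_split]).

No choice of sections is natural as soon as some monomorphism f : M1 -> M0 of
projectives becomes non-injective after tensoring with A
([not_mono_no_natural_splitting]).  Let K be M1 -> M0 in degrees 1 and 0, let K'
be M1 in degree 1, and consider the truncation K -> K'.  It is the zero map on
H_0, hence on Tor, while it embeds H_1(K (x) A) = ker (f (x) A) into
H_1(K' (x) A) = M1 (x) A; naturality then forces the section over K to vanish,
although H_1(K) = 0 makes Tor_1(H_0(K), A) equal to ker (f (x) A).  Over the chain
false < true with the meet as phi, such an f is the inclusion of the submodule
generated at true into the constant module, and A is k at both points with the
zero map between them: a generator u (x) v over (true, false) dies in the constant
module because u comes from false, which identifies u (x) v with the image
of u (x) v over (false, true), where v has become zero. *)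

(** * Persistence modules *)

Section PersistenceModules.
Context {k : fieldType} {d : Order.disp_t} {P : porderType d}.
Implicit Types L M N : pmod k P.

Definition pdiff M N (f g : phom M N) : phom M N.
Proof.
exists (fun p => f p \- g p) => p q h x.
by rewrite /= !pfun_nat linearB.
Defined.

Lemma pincl_inj M (S : psub M) : pinj (pincl S).
Proof. by move=> p; apply: submod_val_inj. Qed.

Lemma pincl_mem M (S : psub M) p (z : psub_pmod S p) : pincl S p z \in S p.
Proof. exact: submod_valP. Qed.

Lemma pincl_in M (S : psub M) p x : x \in S p -> exists z, pincl S p z = x.
Proof. by move=> hx; exists (submod_in hx); apply: submod_inK. Qed.

Section Corestriction.
Variables (M N : pmod k P) (f : phom M N) (S : psub N).
Hypothesis fS : forall p x, f p x \in S p.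

Fact pcorestr_linear p :
  linear (fun x => submod_in (fS x) : submod (S p)).
Proof.
by move=> a x y; apply: submod_val_inj; rewrite [RHS]linearP !submod_inK linearP.
Qed.

Definition pcorestr : phom M (psub_pmod S).
Proof.
exists (fun p => mklin (@pcorestr_linear p)) => p q h x.
by apply: submod_val_inj; rewrite !submod_inK pfun_nat.
Defined.

Lemma pcorestrE p x : pincl S p (pcorestr p x) = f p x.
Proof. exact: submod_inK. Qed.
End Corestriction.

Lemma pproj_surj M (S : psub M) : psurj (pproj S).
Proof. by move=> p y; have [x ->] := quotP y; exists x. Qed.

Lemma pproj_eq0 M (S : psub M) p x : pproj S p x = 0 <-> x \in S p.
Proof.
by have := quotmk_eq (S p) x 0; rewrite subr0 linear0.
Qed.

(** The universal property of a pointwise cokernel, for an arbitrary epimorphism: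
values are computed on preimages picked by choice. *)
Lemma pfactor L M N (e : phom L M) (f : phom L N) :
  psurj e -> (forall p x, e p x = 0 -> f p x = 0) ->
  exists g : phom M N, forall p x, g p (e p x) = f p x.
Proof.
move=> he hf; pose c p y := projT1 (cid (he p y)).
have ec p y : e p (c p y) = y by exact: projT2 (cid (he p y)).
have fE p x y : e p x = e p y -> f p x = f p y.
  move=> h; apply/eqP; rewrite -subr_eq0 -linearB; apply/eqP/hf.
  by rewrite linearB h subrr.
have lin p : linear (fun y => f p (c p y)).
  by move=> a x y; rewrite -linearP; apply: fE; rewrite linearP !ec.
have nat p q (h : (p <= q)%O) y : mklin (lin q) (pmap M h y) =
    pmap N h (mklin (lin p) y).
  by rewrite /= -pfun_nat; apply: fE; rewrite pfun_nat !ec.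
by exists (Phom nat) => p x; apply: fE; rewrite ec.
Qed.

Lemma projective_retract M N (i : phom M N) (r : phom N M) :
  (forall p x, r p (i p x) = x) -> projective N -> projective M.
Proof.
move=> ri pN X Y e f he.
have [g hg] := pN _ _ e (pcomp f r) he.
by exists (pcomp g i) => p x; rewrite /= hg /= ri.
Qed.
End PersistenceModules.

(** * Right exactness of the tensor product *)

Section PhiTensor.
Context {k : fieldType} {d : Order.disp_t} {P : porderType d}.
Variable phi : P *p P -> P.
Implicit Types L M N A : pmod k P.

Lemma tmk0r (V W : lmodType k) (v : V) : tmk v (0 : W) = 0.
Proof.
by have := tmkPr (-1) v (0 : W) 0; rewrite scaleN1r oppr0 addr0 scaleN1r addNr.
Qed.

Lemma ptensor_map_id M A p t : ptensor_map phi (pid M) (pid A) p t = t.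
Proof.
move: t; apply: (@ptensor_ext _ _ _ _ _ _ p _ (ptensor_map phi (pid M) (pid A) p) idfun).
by move=> x hx u v; rewrite ptensor_mapE.
Qed.

Lemma ptensor_mapB M M' A A' (f f' : phom M M') (g : phom A A') p t :
  ptensor_map phi (pdiff f f') g p t =
  ptensor_map phi f g p t - ptensor_map phi f' g p t.
Proof.
move: t; apply: (@ptensor_ext _ _ _ _ _ _ p _ (ptensor_map phi (pdiff f f') g p)
  (ptensor_map phi f g p \- ptensor_map phi f' g p)) => x hx u v.
rewrite [LHS]ptensor_mapE.
have E := congr2 (fun a b => a - b) (ptensor_mapE f g hx u v) (ptensor_mapE f' g hx u v).
apply: (etrans _ (esym E)).
rewrite -linearB; congr (colim_in _ _ _).
have := tmkPl (-1) (f' x.1 u) (f x.1 u) (g x.2 v).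
by rewrite !scaleN1r addrC => ->; rewrite addrC.
Qed.

(** The projection onto the quotient by the image kills the pure tensors, which
span. *)
Lemma ptensor_map_surj M M' A (e : phom M M') :
  psurj e -> psurj (ptensor_map phi e (pid A)).
Proof.
move=> he p y.
pose S := pimg (ptensor_map phi e (pid A)).
suff /pproj_eq0/asboolP[x hx] : pproj S p y = 0 by exists x.
move: y; apply: (@ptensor_ext _ _ _ _ _ _ p _ (pproj S p) \0) => x hx u v.
apply/pproj_eq0/asboolP; have [u' hu'] := he x.1 u.
by exists (colim_in (ptensor_diag M A) hx (tmk u' v)); rewrite ptensor_mapE hu'.
Qed.

(** Right exactness in the first variable, as a universal property: it suffices
to kill the pure tensors whose left factor lies in the kernel of [e].  The
kernel of [ptensor_map e] is controlled by building the factorization directly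
on the colimit, from preimages under [e] picked by choice. *)
Lemma ptensor_factor M M' A N (e : phom M M') (f : phom (ptensor phi M A) N) :
  psurj e ->
  (forall p (x : P *p P) (hx : below phi p x) u v, e x.1 u = 0 ->
     f p (colim_in (ptensor_diag M A) hx (tmk u v)) = 0) ->
  exists g : phom (ptensor phi M' A) N,
    forall p t, g p (ptensor_map phi e (pid A) p t) = f p t.
Proof.
move=> he hf; apply: pfactor; first exact: ptensor_map_surj.
move=> p.
pose c a y := projT1 (cid (he a y)).
have ec a y : e a (c a y) = y by exact: projT2 (cid (he a y)).
pose F x (hx : below phi p x) (u : M x.1) (v : A x.2) :=
  f p (colim_in (ptensor_diag M A) hx (tmk u v)).
have FlP x (hx : below phi p x) v : linear ((F x hx)^~ v).
  by move=> a u u'; rewrite /F tmkPl !linearP.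
have FrP x (hx : below phi p x) u : linear (F x hx u).
  by move=> a v v'; rewrite /F tmkPr !linearP.
have FE x (hx : below phi p x) u u' v : e x.1 u = e x.1 u' -> F x hx u v = F x hx u' v.
  move=> h; apply/eqP; rewrite -subr_eq0.
  have <- : F x hx (-1 *: u' + u) v = F x hx u v - F x hx u' v.
    by rewrite FlP scaleN1r addrC.
  by apply/eqP/hf; rewrite linearP h scaleN1r addNr.
have cl x (hx : below phi p x) v : linear (fun u => F x hx (c x.1 u) v).
  by move=> a u u'; rewrite -FlP; apply: FE; rewrite linearP !ec.
pose h x hx := tensor_lift (cl x hx) (fun u => FrP x hx (c x.1 u)).
have hh (x y : P *p P) (hx : below phi p x) (hy : below phi p y) (le : (x <= y)%O) t :
    h y hy (pmap (ptensor_diag M' A) le t) = h x hx t.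
  move: t; apply: (@tensor_ext _ _ _ _
    (h y hy \o pmap (ptensor_diag M' A) le) (h x hx)) => u v.
  rewrite /= tensor_mapE !tensor_liftE.
  have -> : F x hx (c x.1 u) v =
      F y hy (pmap M (le_pair1 le) (c x.1 u)) (pmap A (le_pair2 le) v).
    have E := colim_in_compat (D := ptensor_diag M A) hx hy le (tmk (c x.1 u) v).
    apply: (congr1 (f p)); apply: (etrans (esym E)).
    by apply: (congr1 (colim_in _ hy)); apply: tensor_mapE.
  by apply: FE; rewrite pfun_nat !ec.
suff E t : colim_lift hh (ptensor_map phi e (pid A) p t) = f p t.
  by move=> t ht; rewrite -E ht linear0.
move: t; apply: (@ptensor_ext _ _ _ _ _ _ p _
  (colim_lift hh \o ptensor_map phi e (pid A) p) (f p)) => x hx u v.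
apply: (etrans (congr1 (colim_lift hh) (ptensor_mapE e (pid A) hx u v))).
rewrite colim_liftE /h tensor_liftE.
by apply: FE; rewrite ec.
Qed.
End PhiTensor.

(** * Homology classes *)

Section Homology.
Context {k : fieldType} {d : Order.disp_t} {P : porderType d}.
Implicit Types C D : cplx k P.

Definition cycmod n C : pmod k P := psub_pmod (cycles n C).

Definition cycincl n C : phom (cycmod n C) (C n) := pincl (cycles n C).

Definition hcls n C : phom (cycmod n C) (homology n C) := pproj _.

Lemma cycincl_inj n C : pinj (cycincl n C).
Proof. exact: pincl_inj. Qed.

Lemma cd_cycincl n C p z : cd C n (n - 1) p (cycincl n C p z) = 0.
Proof. exact/eqP/(pincl_mem z). Qed.

Lemma cycinclP n C p x :
  cd C n (n - 1) p x = 0 -> exists z, cycincl n C p z = x.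
Proof. by move=> hx; apply: pincl_in; apply/eqP. Qed.

(** The differential with values in the cycles.  Working with it rather than with
[cd] replaces K_(n-1) by the projective module Z_(n-1), which maps to
H_(n-1)(K). *)
Definition bdry n C : phom (C n) (cycmod (n - 1) C) :=
  @pcorestr _ _ _ _ _ (cd C n (n - 1)) (cycles (n - 1) C)
    (fun p x => introT eqP (cd_cd _ _ x)).

Lemma bdryE n C p x : cycincl (n - 1) C p (bdry n C p x) = cd C n (n - 1) p x.
Proof. exact: pcorestrE. Qed.

Lemma bdry_eq0 n C p x : bdry n C p x = 0 <-> cd C n (n - 1) p x = 0.
Proof.
rewrite -bdryE; split=> [->|h]; first exact: linear0.
by apply: cycincl_inj; rewrite h linear0.
Qed.

Lemma hcls_surj n C : psurj (hcls n C).
Proof. exact: pproj_surj. Qed.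

Lemma hcls_eq0 n C p z :
  hcls n C p z = 0 <-> exists y, cd C (n + 1) n p y = cycincl n C p z.
Proof.
apply: (iff_trans (@pproj_eq0 _ _ _ _ (ppreim (pincl (cycles n C)) (boundaries n C)) p z)).
exact: (iff_sym (rwP (asboolP _))).
Qed.

(** In degree n - 1 the boundaries are images from degree n - 1 + 1; this
restates [hcls_eq0] with degree n itself. *)
Lemma hcls_bdry n C p z :
  hcls (n - 1) C p z = 0 <-> exists y, bdry n C p y = z.
Proof.
apply: (iff_trans (@hcls_eq0 (n - 1) C p z)); rewrite subrK.
split=> -[y hy]; exists y; last by rewrite -bdryE hy.
by apply: cycincl_inj; rewrite bdryE.
Qed.

Lemma hcls_eq n C p z z' y : cd C (n + 1) n p y = cycincl n C p z - cycincl n C p z' ->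
  hcls n C p z = hcls n C p z'.
Proof.
move=> hy; apply/eqP; rewrite -subr_eq0 -linearB; apply/eqP/hcls_eq0.
by exists y; rewrite hy linearB.
Qed.

Section Induced.
Variables (C D : cplx k P) (n m : int).

(** A map between single terms of two complexes, in possibly different degrees,
may induce a map on homology without being part of a chain map. *)
Definition induces (G : phom (C n) (D m)) (b : phom (homology n C) (homology m D)) :=
  forall p z, exists w,
    cycincl m D p w = G p (cycincl n C p z) /\ b p (hcls n C p z) = hcls m D p w.

Lemma induced_ex (G : phom (C n) (D m)) :
  (forall p x, cd C n (n - 1) p x = 0 -> cd D m (m - 1) p (G p x) = 0) ->
  (forall p y, exists y', cd D (m + 1) m p y' = G p (cd C (n + 1) n p y)) ->
  exists b, induces G b.
Proof.
move=> Gcyc Gbd.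
have Gmem p z : pcomp G (cycincl n C) p z \in cycles m D p.
  exact/eqP/Gcyc/cd_cycincl.
have [b hb] : exists b : phom (homology n C) (homology m D),
    forall p z, b p (hcls n C p z) = pcomp (hcls m D) (pcorestr Gmem) p z.
  apply: pfactor; first exact: hcls_surj.
  move=> p z /hcls_eq0[y hy]; apply/hcls_eq0.
  have [y' hy'] := Gbd p y; exists y'.
  by rewrite hy' hy; apply/esym/(pcorestrE Gmem).
exists b => p z; exists (pcorestr Gmem p z); split; last exact: hb.
exact: (pcorestrE Gmem).
Qed.

Lemma induces_eq (G G' : phom (C n) (D m)) b b' :
  induces G b -> induces G' b' ->
  (forall p x, cd C n (n - 1) p x = 0 ->
     exists y, cd D (m + 1) m p y = G p x - G' p x) ->
  forall p h, b p h = b' p h.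
Proof.
move=> hb hb' GG' p h; have [z <-] := hcls_surj h.
have [w [hw ->]] := hb p z; have [w' [hw' ->]] := hb' p z.
have [y hy] := GG' p _ (cd_cycincl z).
by apply: (hcls_eq (y := y)); rewrite hw hw'.
Qed.
End Induced.

Lemma induces_id n C : induces (pid (C n)) (pid (homology n C)).
Proof. by move=> p z; exists z. Qed.

Lemma induces_comp C C' C'' n n' n'' (G : phom (C n) (C' n'))
    (G' : phom (C' n') (C'' n'')) b b' :
  induces G b -> induces G' b' -> induces (pcomp G' G) (pcomp b' b).
Proof.
move=> hb hb' p z; have [w [hw Hw]] := hb p z; have [v [hv Hv]] := hb' p w.
exists v; split; first exact: etrans hv (congr1 (G' p) hw).
exact: etrans (congr1 (b' p) Hw) Hv.
Qed.

Lemma homology_map_hcls C C' (f : cmap C C') n p z :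
  homology_map f n p (hcls n C p z) = hcls n C' p (cycles_map f n p z).
Proof. exact: (pquot_homE (@homology_map_subproof _ _ _ _ _ f n)). Qed.

Lemma cycincl_cycles_map C C' (f : cmap C C') n p z :
  cycincl n C' p (cycles_map f n p z) = f n p (cycincl n C p z).
Proof. exact: submod_inK. Qed.

Lemma induces_homology_map C C' (f : cmap C C') n :
  induces (f n) (homology_map f n).
Proof.
move=> p z; exists (cycles_map f n p z); split.
  exact: cycincl_cycles_map.
exact: homology_map_hcls.
Qed.
End Homology.
Arguments induces {k d P C D n m}.

(** * Retraction onto the cycles and the left-hand map *)

(* Unification must compare such maps by their arguments, without unfolding the
   colimits behind them. *)
Opaque ptensor_map.

Section Kunneth.
Context {k : fieldType} {d : Order.disp_t} {P : porderType d}.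
Variable phi : P *p P -> P.
Implicit Types (K : cplx k P) (A M : pmod k P) (n : int).

Lemma ptensor_map_compE M M1 M' A A1 A'
    (f : phom M M1) (g : phom M1 M') (h : phom M M')
    (a : phom A A1) (b : phom A1 A') (c : phom A A') :
  (forall p x, g p (f p x) = h p x) -> (forall p x, b p (a p x) = c p x) ->
  forall p t, ptensor_map phi g b p (ptensor_map phi f a p t) = ptensor_map phi h c p t.
Proof.
by move=> gf ba p t; rewrite ptensor_map_comp; apply: eq_ptensor_map.
Qed.

Lemma ptensor_map_sq M M1 M2 M' A A1 A2 A'
    (f : phom M M1) (g : phom M1 M') (f' : phom M M2) (g' : phom M2 M')
    (a : phom A A1) (b : phom A1 A') (a' : phom A A2) (b' : phom A2 A') :
  (forall p x, g p (f p x) = g' p (f' p x)) ->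
  (forall p x, b p (a p x) = b' p (a' p x)) -> forall p t,
  ptensor_map phi g b p (ptensor_map phi f a p t) =
  ptensor_map phi g' b' p (ptensor_map phi f' a' p t).
Proof.
by move=> fg ab p t; rewrite !ptensor_map_comp; apply: eq_ptensor_map.
Qed.

Notation tens A f := (ptensor_map phi f (pid A)).

Lemma tens_comp A M M1 M' (f : phom M M1) (g : phom M1 M') (h : phom M M') :
  (forall p x, g p (f p x) = h p x) -> forall p t,
  tens A g p (tens A f p t) = tens A h p t.
Proof. by move=> gf; apply: ptensor_map_compE. Qed.

Lemma tens_comp0 A M M1 M' (f : phom M M1) (g : phom M1 M') :
  (forall p x, g p (f p x) = 0) -> forall p t, tens A g p (tens A f p t) = 0.
Proof. by move=> gf p t; rewrite ptensor_map_comp; apply: ptensor_map0l. Qed.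

(** A section s of the projection e of K_n onto the projective module B_(n-1)
gives the projection 1 - s e onto the kernel Z_n. *)
Lemma cycles_retract n K : proj_cplx K ->
  exists r : phom (K n) (cycmod n K), forall p z, r p (cycincl n K p z) = z.
Proof.
case=> _ pB.
have {}pB : projective (psub_pmod (pimg (cd K n (n - 1)))).
  by have := pB (n - 1); rewrite /boundaries subrK.
have memB p x : cd K n (n - 1) p x \in pimg (cd K n (n - 1)) p.
  by apply/asboolP; exists x.
pose e := pcorestr memB.
have eE p x : pincl _ p (e p x) = cd K n (n - 1) p x by exact: pcorestrE.
have se : psurj e.
  move=> p y; have /asboolP[x hx] := pincl_mem y; exists x.
  by apply: pincl_inj; rewrite eE.
have [s hs] := pB _ _ e (pid _) se.
pose c := pdiff (pid (K n)) (pcomp s e).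
have memc p x : c p x \in cycles n K p.
  by apply/eqP; rewrite linearB -!eE hs subrr.
exists (pcorestr memc) => p z; apply: cycincl_inj.
apply: (etrans (pcorestrE memc _)).
rewrite /c -[LHS]/(cycincl n K p z - s p (e p (cycincl n K p z))).
suff -> : e p (cycincl n K p z) = 0 by rewrite linear0 subr0.
by apply: pincl_inj; rewrite eE cd_cycincl linear0.
Qed.

Lemma cycmod_projective n K : proj_cplx K -> projective (cycmod n K).
Proof.
move=> hK; have [r hr] := cycles_retract n hK.
exact: (projective_retract hr (hK.1 n)).
Qed.

(** As Z_(n-1) is a direct summand of K_(n-1), tensoring the inclusion
Z_(n-1) -> K_(n-1) keeps it injective. *)
Lemma tens_bdry n K A p t : proj_cplx K ->
  tens A (cd K n (n - 1)) p t = 0 -> tens A (bdry n K) p t = 0.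
Proof.
move=> hK ht; have [r hr] := cycles_retract (n - 1) hK.
rewrite -(@tens_comp A _ _ _ (cd K n (n - 1)) r (bdry n K)) ?ht ?linear0 //.
by move=> q x; rewrite -bdryE hr.
Qed.

Section LeftMap.
Variables (n : int) (K : cplx k P) (A : pmod k P).

(** The formula [z] (x) a |-> [z (x) a].  It determines the map, since Z_n (x) A
maps onto H_n(K) (x) A. *)
Definition is_left_map
    (a : phom (ptensor phi (homology n K) A) (homology n (ctensor phi K A))) :=
  forall p z, exists w, cycincl n (ctensor phi K A) p w = tens A (cycincl n K) p z
    /\ a p (tens A (hcls n K) p z) = hcls n (ctensor phi K A) p w.

Lemma left_map_ex : exists a, is_left_map a.
Proof.
have mem p z : tens A (cycincl n K) p z \in cycles n (ctensor phi K A) p.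
  by apply/eqP/tens_comp0/cd_cycincl.
have memE := pcorestrE (S := cycles n (ctensor phi K A)) mem.
pose f := pcomp (hcls n (ctensor phi K A))
  (pcorestr (S := cycles n (ctensor phi K A)) mem).
have [|a ha] := ptensor_factor (f := f) (@hcls_surj _ _ _ n K); last first.
  exists a => p z; exists (pcorestr mem p z); split; first exact: memE.
  exact: ha.
move=> p x hx u v /hcls_eq0[y hy]; apply/hcls_eq0.
exists (colim_in (ptensor_diag (K (n + 1)) A) hx (tmk y v)).
rewrite memE; apply: (etrans (ptensor_mapE _ _ _ _ _)).
by rewrite hy; apply/esym/ptensor_mapE.
Qed.
End LeftMap.

(** If the cycle z of Z_n (x) A equals (d (x) A) y, apply the retraction r onto
Z_n: z = (r d (x) A) y, and r d takes values in boundaries, so z dies in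
H_n(K) (x) A. *)
Lemma left_map_inj n K A a : proj_cplx K -> @is_left_map n K A a -> pinj a.
Proof.
move=> hK ha p.
suff inj0 h : a p h = 0 -> h = 0.
  move=> x y hxy; apply/eqP; rewrite -subr_eq0; apply/eqP/inj0.
  by rewrite linearB hxy subrr.
have [z <-] := ptensor_map_surj (phi := phi) (A := A) (@hcls_surj _ _ _ n K) h.
have [w [hw ->]] := ha p z => /hcls_eq0[y hy].
have [r hr] := cycles_retract n hK.
pose c := pcomp r (cd K (n + 1) n).
have <- : tens A c p y = z.
  have E1 := @tens_comp A _ _ _ (cd K (n + 1) n) r c (fun _ _ => erefl) p y.
  have E2 := @tens_comp A _ _ _ (cycincl n K) r (pid _) hr p z.
  apply: (etrans (esym E1)); apply: etrans (etrans E2 (ptensor_map_id z)).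
  exact: congr1 (etrans hy hw).
apply: tens_comp0 => q x; apply/hcls_eq0; exists x.
have hc : cd K n (n - 1) q (cd K (n + 1) n q x) = 0 by exact: cd_cd.
by have [z' hz'] := cycinclP hc; rewrite -[c q x]/(r q (cd K (n + 1) n q x)) -hz' hr.
Qed.

(** * The right-hand map *)

Lemma resolution_exact1 M (R : presolution M) p (x : R 1 p) :
  cd R 1 0 p x = 0 <-> exists y, cd R (1 + 1) 1 p y = x.
Proof. exact: (@rexact _ _ _ M R 1 isT p x). Qed.

(** The first two steps of the comparison theorem, for a pair (D1, D0) from
X1 -> X0 to R_1 -> R_0 lifting the zero map. *)
Lemma homotopy_deg1 M (R : presolution M) (X0 X1 : pmod k P)
    (e : phom X1 X0) (D0 : phom X0 (R 0)) (D1 : phom X1 (R 1)) :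
  projective X0 -> projective X1 ->
  (forall p x, raug R p (D0 p x) = 0) ->
  (forall p x, cd R 1 0 p (D1 p x) = D0 p (e p x)) ->
  exists (h0 : phom X0 (R 1)) (h1 : phom X1 (R (1 + 1))),
    forall p x, cd R (1 + 1) 1 p (h1 p x) = pdiff D1 (pcomp h0 e) p x.
Proof.
move=> pX0 pX1 D0_aug D1_d.
have [h0 hh0] := projective_factor (g := D0) (u := cd R 1 0) (v := raug R) pX0
  (fun p y => (raug_exact y).1) D0_aug.
pose E := pdiff D1 (pcomp h0 e).
have E_d p x : cd R 1 0 p (E p x) = 0.
  rewrite -[E p x]/(D1 p x - h0 p (e p x)).
  by rewrite linearB hh0 D1_d subrr.
have [h1 hh1] := projective_factor (g := E) (u := cd R (1 + 1) 1) (v := cd R 1 0)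
  pX1 (fun p y => (resolution_exact1 y).1) E_d.
by exists h0, h1.
Qed.

(** Hence, after tensoring, such a D1 sends the elements killed by [e] to
boundaries: the term h0 e of the homotopy vanishes on them. *)
Lemma homotopy_tens M (R : presolution M) (X0 X1 : pmod k P)
    (e : phom X1 X0) (D0 : phom X0 (R 0)) (D1 : phom X1 (R 1)) :
  projective X0 -> projective X1 ->
  (forall p x, raug R p (D0 p x) = 0) ->
  (forall p x, cd R 1 0 p (D1 p x) = D0 p (e p x)) ->
  forall A A' (g : phom A A') p t, tens A e p t = 0 ->
  exists y, tens A' (cd R (1 + 1) 1) p y = ptensor_map phi D1 g p t.
Proof.
move=> pX0 pX1 D0_aug D1_d A A' g p t ht.
have [h0 [h1 hh]] := homotopy_deg1 pX0 pX1 D0_aug D1_d.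
exists (ptensor_map phi h1 g p t).
have E := ptensor_map_compE (a := g) (b := pid A') (c := g) hh (fun _ _ => erefl) t.
apply: (etrans E); apply: (etrans (ptensor_mapB _ _ _ _)).
have E0 := ptensor_map_compE (a := pid A) (b := g) (c := g)
  (fun q x => erefl (pcomp h0 e q x)) (fun _ _ => erefl) t.
have {}E0 : ptensor_map phi (pcomp h0 e) g p t = 0.
  exact: etrans (esym E0) (etrans (congr1 _ ht) (linear0 _)).
exact: etrans (congr1 (fun u => _ - u) E0) (subr0 _).
Qed.

Section Def.
Variables (n : int) (K : cplx k P) (A : pmod k P).
Variable R : presolution (homology (n - 1) K).

(** A lift of Z_(n-1) -> H_(n-1)(K) to the resolution, continued over the boundary
map. *)
Record lifts_classes (G0 : phom (cycmod (n - 1) K) (R 0)) (G1 : phom (K n) (R 1)) :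
    Prop := LiftsClasses {
  lc_aug : forall p z, raug R p (G0 p z) = hcls (n - 1) K p z;
  lc_d : forall p x, cd R 1 0 p (G1 p x) = G0 p (bdry n K p x) }.

Definition is_connecting
    (b : phom (homology n (ctensor phi K A)) (homology 1 (ctensor phi R A))) :=
  exists G0 G1, lifts_classes G0 G1 /\
    induces (C := ctensor phi K A) (D := ctensor phi R A) (tens A G1) b.

Hypothesis hK : proj_cplx K.

Lemma lifts_classes_ex : exists G0 G1, lifts_classes G0 G1.
Proof.
have pZ := cycmod_projective (n := n - 1) hK.
have [G0 hG0] := pZ _ _ (raug R) (hcls (n - 1) K) (@raug_surj _ _ _ _ R).
have aug0 p x : raug R p (pcomp G0 (bdry n K) p x) = 0.
  by rewrite hG0; apply/hcls_bdry; exists x.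
have [G1 hG1] := projective_factor (g := pcomp G0 (bdry n K)) (u := cd R 1 0)
  (v := raug R) (hK.1 n) (fun p y => (raug_exact y).1) aug0.
by exists G0, G1.
Qed.

Lemma lifts_classes_cycle G0 G1 p t : lifts_classes G0 G1 ->
  tens A (cd K n (n - 1)) p t = 0 -> tens A (cd R 1 0) p (tens A G1 p t) = 0.
Proof.
move=> hG /(tens_bdry hK) ht.
rewrite (ptensor_map_sq (f' := bdry n K) (g' := G0) (a' := pid A) (b' := pid A)) //.
  by rewrite ht linear0.
exact: lc_d hG.
Qed.

Lemma connecting_ex : exists b, is_connecting b.
Proof.
have [G0 [G1 hG]] := lifts_classes_ex.
have d0 p x : cd R 1 0 p (pcomp G1 (cd K (n + 1) n) p x) = 0.
  rewrite -[pcomp _ _ p x]/(G1 p (cd K (n + 1) n p x)) (lc_d hG).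
  by rewrite ((bdry_eq0 _).2 (cd_cd _ _ x)) linear0.
have [G2 hG2] := projective_factor (g := pcomp G1 (cd K (n + 1) n))
  (u := cd R (1 + 1) 1) (v := cd R 1 0) (hK.1 (n + 1))
  (fun p y => (resolution_exact1 y).1) d0.
have [||b hb] := @induced_ex _ _ _ (ctensor phi K A) (ctensor phi R A) n 1 (tens A G1).
- by move=> p t; apply: lifts_classes_cycle hG.
- move=> p y; exists (tens A G2 p y).
  exact: (ptensor_map_sq (f' := cd K (n + 1) n) (g' := G1) (a' := pid A) (b' := pid A)).
by exists b, G0, G1.
Qed.

Variables (a : phom (ptensor phi (homology n K) A) (homology n (ctensor phi K A))).
Variables (b : phom (homology n (ctensor phi K A)) (homology 1 (ctensor phi R A))).
Hypotheses (ha : is_left_map a) (hb : is_connecting b).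

(** On Z_n, G1 takes values in the kernel of R_1 -> R_0, so it factors through R_2;
a class represented in Z_n (x) A is therefore sent to a boundary. *)
Lemma connecting_left0 p h : b p (a p h) = 0.
Proof.
have [G0 [G1 [hG bG]]] := hb.
have [z <-] := ptensor_map_surj (phi := phi) (A := A) (@hcls_surj _ _ _ n K) h.
have [w [hw ->]] := ha z; have [v [hv ->]] := bG p w.
have d0 q x : cd R 1 0 q (pcomp G1 (cycincl n K) q x) = 0.
  rewrite -[pcomp _ _ q x]/(G1 q (cycincl n K q x)) (lc_d hG).
  by rewrite ((bdry_eq0 _).2 (cd_cycincl x)) linear0.
have [g hg] := projective_factor (g := pcomp G1 (cycincl n K))
  (u := cd R (1 + 1) 1) (v := cd R 1 0) (cycmod_projective hK)
  (fun p y => (resolution_exact1 y).1) d0.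
apply/hcls_eq0; exists (tens A g p z).
apply: etrans (esym (etrans hv (congr1 _ hw))).
exact: (ptensor_map_sq (f' := cycincl n K) (g' := G1) (a' := pid A) (b' := pid A)).
Qed.

(** The section S1 and the exactness at H_n(K (x) A) are proved together as both
rest on comparing S1 G1 and G1 S1 with the identity. *)
Lemma connecting_split :
  exists s : phom (homology 1 (ctensor phi R A)) (homology n (ctensor phi K A)),
    (forall p z, b p (s p z) = z) /\
    (forall p h, b p h = 0 -> exists t, a p t = h).
Proof.
have [G0 [G1 [hG bG]]] := hb.
have pZ := cycmod_projective (n := n - 1) hK.
have pR i : projective (R i) by apply: rproj.
have [S0 hS0] := pR 0 _ _ (hcls (n - 1) K) (raug R) (@hcls_surj _ _ _ _ _).
have aug0 p x : hcls (n - 1) K p (pcomp S0 (cd R 1 0) p x) = 0.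
  by rewrite hS0; apply/raug_exact; exists x.
have [T hT] := projective_factor (g := pcomp S0 (cd R 1 0)) (u := bdry n K)
  (v := hcls (n - 1) K) (pR 1) (fun p y => (hcls_bdry y).1) aug0.
have [r hr] := cycles_retract n hK.
(* T lifts S0 over the boundary map, but T d2 is only a cycle of K_n; removing
   the component of T in Z_n makes the composite with d2 vanish. *)
pose S1 := pdiff T (pcomp (cycincl n K) (pcomp r T)).
have S1E p x : S1 p x = T p x - cycincl n K p (r p (T p x)) by [].
have S1_d p x : bdry n K p (S1 p x) = S0 p (cd R 1 0 p x).
  by rewrite S1E linearB ((bdry_eq0 _).2 (cd_cycincl _)) subr0 hT.
have S1_0 p x : S1 p (cd R (1 + 1) 1 p x) = 0.
  have hd : cd R 1 0 p (cd R (1 + 1) 1 p x) = 0 by exact: cd_cd.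
  have h0 : bdry n K p (T p (cd R (1 + 1) 1 p x)) = 0.
    by rewrite hT -[LHS]/(S0 p (cd R 1 0 p (cd R (1 + 1) 1 p x))) hd linear0.
  have [z hz] := cycinclP ((bdry_eq0 _).1 h0).
  by rewrite S1E -hz hr subrr.
have [||s hs] := @induced_ex _ _ _ (ctensor phi R A) (ctensor phi K A) 1 n (tens A S1).
- move=> p t ht.
  have E q x : cd K n (n - 1) q (S1 q x) =
      pcomp (cycincl (n - 1) K) S0 q (cd R 1 0 q x).
    by rewrite -bdryE S1_d.
  apply: (etrans (ptensor_map_sq (a' := pid A) (b' := pid A) E (fun _ _ => erefl) t)).
  exact: etrans (congr1 _ ht) (linear0 _).
- by move=> p y; exists 0; rewrite linear0; apply/esym/tens_comp0/S1_0.
exists s; split=> [p z|p h bh].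
  pose D0 := pdiff (pcomp G0 S0) (pid (R 0)).
  pose D1 := pdiff (pcomp G1 S1) (pid (R 1)).
  have D0_aug q x : raug R q (D0 q x) = 0.
    by rewrite linearB (lc_aug hG) hS0 subrr.
  have D1_d q x : cd R 1 0 q (D1 q x) = D0 q (cd R 1 0 q x).
    rewrite linearB; congr (_ - _).
    by rewrite -[LHS]/(cd R 1 0 q (G1 q (S1 q x))) (lc_d hG) S1_d.
  have E := induces_eq (induces_comp hs bG) (induces_id (n := 1) (C := ctensor phi R A)).
  apply: (E _ p z) => q x hx {E}.
  have [y hy] := homotopy_tens (pR 0) (pR 1) D0_aug D1_d (pid A) hx.
  exists y; apply: (etrans hy); apply: (etrans (ptensor_mapB _ _ _ _)).
  have E := tens_comp (A := A) (fun q x => erefl (pcomp G1 S1 q x)) x.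
  apply: (congr2 (fun u v : ptensor phi (R 1) A q => u - v)); first exact: esym E.
  exact: ptensor_map_id.
(* N is a homotopy between 1 and S0 G0 on Z_(n-1); subtracting it from 1 - S1 G1
   leaves a map E from K_n into the cycles. *)
have S0G0 q x : hcls (n - 1) K q (pdiff (pid _) (pcomp S0 G0) q x) = 0.
  by rewrite linearB -[pcomp S0 G0 q x]/(S0 q (G0 q x)) hS0 (lc_aug hG) subrr.
have [N hN] := projective_factor (g := pdiff (pid _) (pcomp S0 G0))
   (u := bdry n K) (v := hcls (n - 1) K) pZ (fun p y => (hcls_bdry y).1) S0G0.
pose E := pdiff (pdiff (pid (K n)) (pcomp S1 G1)) (pcomp N (bdry n K)).
have E_d q x : bdry n K q (E q x) = 0.
  rewrite -[E q x]/(x - S1 q (G1 q x) - N q (bdry n K q x)).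
  by rewrite 2!linearB hN S1_d (lc_d hG) subrr.
have memE q x : E q x \in cycles n K q by apply/eqP/bdry_eq0/E_d.
pose c := pcorestr memE.
have cE q x : cycincl n K q (c q x) = E q x by exact: pcorestrE.
(* As S1 G1 x represents s (b [x]) = 0, the cycles x and E x are homologous, and
   E x lies in the image of Z_n (x) A. *)
have [z hz] := hcls_surj h; subst h.
have [v [hv bv]] := bG p z; have [u [hu su]] := hs p v.
have u0 : hcls n (ctensor phi K A) p u = 0.
  exact: etrans (esym su) (etrans (congr1 (s p) (etrans (esym bv) bh)) (linear0 _)).
pose x := cycincl n (ctensor phi K A) p z.
have [w [hw aw]] := ha (tens A c p x).
exists (tens A (hcls n K) p (tens A c p x)); apply: (etrans aw).
suff -> : w = z - u by rewrite linearB u0 subr0.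
apply: cycincl_inj; rewrite linearB; apply: (etrans hw).
have E1 := tens_comp (A := A) cE x; apply: (etrans E1).
have bx0 : tens A (bdry n K) p x = 0 by apply: (tens_bdry hK); apply: (cd_cycincl z).
have E2 := tens_comp (A := A) (fun q y => erefl (pcomp N (bdry n K) q y)) x.
have {}E2 : tens A (pcomp N (bdry n K)) p x = 0.
  exact: etrans (esym E2) (etrans (congr1 _ bx0) (linear0 _)).
have E3 := tens_comp (A := A) (fun q y => erefl (pcomp S1 G1 q y)) x.
apply: (etrans (ptensor_mapB _ _ _ _)).
apply: (etrans (congr1 (fun u => _ - u) E2)); apply: (etrans (subr0 _)).
apply: (etrans (ptensor_mapB _ _ _ _)).
apply: (congr2 (fun u v : ptensor phi (K n) A p => u - v)).
  exact: ptensor_map_id.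
exact: etrans (esym E3) (esym (etrans hu (congr1 _ hv))).
Qed.
End Def.

Lemma bdry_nat K K' (f : cmap K K') n p x :
  bdry n K' p (f n p x) = cycles_map f (n - 1) p (bdry n K p x).
Proof. by apply: cycincl_inj; rewrite cycincl_cycles_map !bdryE cfun_d. Qed.

Lemma left_map_natural n K K' A A' a a' (f : cmap K K') (g : phom A A') p t :
  @is_left_map n K A a -> @is_left_map n K' A' a' ->
  a' p (ptensor_map phi (homology_map f n) g p t) =
  homology_map (ctensor_map phi f g) n p (a p t).
Proof.
move=> ha ha'.
have [z <-] := ptensor_map_surj (phi := phi) (A := A) (@hcls_surj _ _ _ n K) t.
have E := ptensor_map_sq (f' := cycles_map f n) (g' := hcls n K')
  (a := pid A) (b := g) (a' := g) (b' := pid A') (@homology_map_hcls _ _ _ _ _ f n)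
  (fun _ _ => erefl) z.
apply: (etrans (congr1 (a' p) E)).
have [w [hw ->]] := ha p z; have [w' [hw' ->]] := ha' p (ptensor_map phi (cycles_map f n) g p z).
have {}E := homology_map_hcls (ctensor_map phi f g) w.
apply: etrans (esym E); congr (hcls _ _ _ _); apply: cycincl_inj.
apply: (etrans hw'); apply: etrans (esym (cycincl_cycles_map (ctensor_map phi f g) w)).
apply: etrans (esym (congr1 _ hw)).
exact: (ptensor_map_sq (a := g) (b := pid A') (a' := pid A) (b' := g)
  (@cycincl_cycles_map _ _ _ _ _ f n)).
Qed.

(** Both composites are induced by lifts of the same map Z_(n-1)(K) -> H_(n-1)(K'),
namely (G0', G1') after f and F after (G0, G1); their difference is null-homotopic
on cycles. *)
Lemma connecting_natural n K K' A A' (R : presolution (homology (n - 1) K))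
    (R' : presolution (homology (n - 1) K')) b b' (f : cmap K K') (g : phom A A')
    (F : cmap R R') p t :
  proj_cplx K -> @is_connecting n K A R b -> @is_connecting n K' A' R' b' ->
  lifts (homology_map f (n - 1)) F ->
  b' p (homology_map (ctensor_map phi f g) n p t) =
  homology_map (ctensor_map phi F g) 1 p (b p t).
Proof.
move=> hK [G0 [G1 [hG bG]]] [G0' [G1' [hG' bG']]] hF.
pose D0 := pdiff (pcomp G0' (cycles_map f (n - 1))) (pcomp (F 0) G0).
pose D1 := pdiff (pcomp G1' (f n)) (pcomp (F 1) G1).
have D0_aug q x : raug R' q (D0 q x) = 0.
  rewrite linearB; apply/eqP; rewrite subr_eq0; apply/eqP.
  apply: (etrans (lc_aug hG' _)); apply: etrans (esym (hF _ _)).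
  by rewrite (lc_aug hG) homology_map_hcls.
have D1_d q x : cd R' 1 0 q (D1 q x) = D0 q (bdry n K q x).
  rewrite linearB; congr (_ - _).
    apply: (etrans (lc_d hG' _)); exact: congr1 (bdry_nat _ _).
  by apply: (etrans (esym (cfun_d _ _ _))); rewrite (lc_d hG).
have E := induces_eq
  (induces_comp (@induces_homology_map _ _ _ _ _ (ctensor_map phi f g) n) bG')
  (induces_comp bG (@induces_homology_map _ _ _ _ _ (ctensor_map phi F g) 1)).
apply: (E _ p t) => q x hx {E}.
have [y hy] := homotopy_tens (cycmod_projective hK) (hK.1 n) D0_aug D1_d g (tens_bdry hK hx).
exists y; apply: (etrans hy); apply: (etrans (ptensor_mapB _ _ _ _)).
apply: (congr2 (fun u v : ptensor phi (R' 1) A' q => u - v)).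
  exact/esym/ptensor_map_compE.
exact/esym/ptensor_map_compE.
Qed.
End Kunneth.

(** * Natural splittings force tensoring to preserve monomorphisms *)

Section MonoTensor.
Context {k : fieldType} {d : Order.disp_t} {P : porderType d}.
Variable phi : P *p P -> P.
Implicit Types (K : cplx k P) (M N A : pmod k P).

Notation tens A f := (ptensor_map phi f (pid A)).

Lemma zero_projective N : (forall p (x : N p), x = 0) -> projective N.
Proof.
by move=> N0 X Y e f _; exists (pzero _ _) => p x; rewrite (N0 p x) !linear0.
Qed.

(** The image of a monomorphism is isomorphic to its source. *)
Lemma pimg_mono_projective M N (f : phom M N) :
  pinj f -> projective M -> projective (psub_pmod (pimg f)).
Proof.
move=> fI pM.
have mem p x : f p x \in pimg f p by apply/asboolP; exists x.
pose e := pcorestr mem; have eE p x : pincl _ p (e p x) = f p x by exact: pcorestrE.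
have eS : psurj e.
  move=> p y; have /asboolP[x hx] := pincl_mem y; exists x.
  by apply: pincl_inj; rewrite eE.
have [|g hg] := pfactor (f := pid M) eS.
  by move=> p x hx; apply: fI; rewrite -eE hx !linear0.
apply: (projective_retract (i := g) (r := e)) pM => p y.
by have [x <-] := eS p y; rewrite hg.
Qed.

Section TwoTerm.
Variables (M1 M0 : pmod k P) (f : phom M1 M0).

Definition two_term_obj (i : int) : pmod k P :=
  match i with Posz 0 => M0 | Posz 1 => M1 | _ => pnull M0 end.

Definition two_term_d (i j : int) : phom (two_term_obj i) (two_term_obj j) :=
  match i, j with Posz 1, Posz 0 => f | _, _ => pzero _ _ end.

Lemma two_term_d0 i j : j != 0 -> forall p x, two_term_d i j p x = 0.
Proof. by case: i j => [[|[|i]]|i] [[|[|j]]|j]. Qed.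

Definition two_term : cplx k P.
Proof.
exists two_term_obj two_term_d.
  by move=> [[|[|i]]|i] [[|[|j]]|j].
by move=> [[|[|i]]|i] [[|[|j]]|j] [[|[|l]]|l] p x //=; rewrite linear0.
Defined.

Lemma two_term_proj : projective M1 -> projective M0 ->
  projective (psub_pmod (pimg f)) -> proj_cplx two_term.
Proof.
move=> pM1 pM0 pI; split.
  by move=> [[|[|i]]|i] //=; apply: pnull_projective.
move=> i; have [->|i0] := eqVneq i 0.
  exact: pI.
apply: zero_projective => p x; apply: pincl_inj.
have /asboolP[y <-] := pincl_mem x; rewrite linear0.
exact: two_term_d0.
Qed.

End TwoTerm.

Definition trunc_map M1 M0 (f : phom M1 M0) :
  cmap (two_term f) (two_term (pzero M1 (pnull M0))).
Proof.
pose g (i : int) : phom (two_term_obj M1 M0 i) (two_term_obj M1 (pnull M0) i) :=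
  match i with Posz 1 => pid M1 | _ => pzero _ _ end.
exists g => i j p x.
rewrite -[RHS]/(two_term_d (pzero M1 (pnull M0)) i j p (g i p x)).
rewrite -[LHS]/(g j p (two_term_d f i j p x)).
move: x; case: i j => [[|[|i]]|i] [[|[|j]]|j] x //=; exact: linear0.
Defined.

(** The truncation of M1 -> M0 to M1 -> 0 kills H_0, so the zero chain map lifts its
effect there and naturality makes the image of the section vanish in M1 (x) A.  As
the truncation is injective on cycles of degree 1, the section itself vanishes,
hence so does [beta] over K; since H_1(K) = 0, exactness leaves no room for
ker (f (x) A). *)
Lemma not_mono_no_natural_splitting M1 M0 A (f : phom M1 M0)
    (Q : forall M : pmod k P, presolution M)
    (alpha : kunneth_left_type phi 1) (beta : kunneth_right_type phi Q 1)
    (s : splitting_type phi Q 1 A) :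
  projective M1 -> projective M0 -> pinj f ->
  kunneth_sequence alpha beta ->
  (forall (K : cplx k P) (hK : proj_cplx K) p z, beta K hK A p (s K hK p z) = z) ->
  splitting_natural s -> forall p t, tens A f p t = 0 -> t = 0.
Proof.
move=> pM1 pM0 fI [ex _ _] beta_s s_nat p t ft0.
pose K := two_term f; pose K' := two_term (pzero M1 (pnull M0)).
pose c : cmap K K' := trunc_map f.
have hK : proj_cplx K by apply: two_term_proj => //; apply: pimg_mono_projective.
have N0 q (x : pnull M0 q) : x = 0 by exact: pnull0.
have hK' : proj_cplx K'.
  apply: two_term_proj => //; first exact: pnull_projective.
  by apply: zero_projective => q x; apply: pincl_inj; rewrite (N0 _ (pincl _ _ _)) linear0.
have H0 q (x : homology (1 - 1) K' q) : x = 0.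
  have [z <-] := hcls_surj x; suff -> : z = 0 by rewrite linear0.
  by apply: cycincl_inj; rewrite linear0; apply: (N0 q).
have F_d i j q x : (pzero (Q (homology (1 - 1) K) j) (Q (homology (1 - 1) K') j)) q
    (cd (Q (homology (1 - 1) K)) i j q x) =
  cd (Q (homology (1 - 1) K')) i j q
    ((pzero (Q (homology (1 - 1) K) i) (Q (homology (1 - 1) K') i)) q x).
  by rewrite linear0.
pose F := @Cmap _ _ _ (Q (homology (1 - 1) K)) (Q (homology (1 - 1) K')) (fun i => pzero _ _) F_d.
have hF : lifts (homology_map c (1 - 1)) F.
  by move=> q x; rewrite [RHS]H0; apply: linear0.
have F0 q z : Tor_map phi 1 F (pid A) q z = 0.
  have [z' <-] := hcls_surj z.
  have [w [hw Hw]] := @induces_homology_map _ _ _ _ _ (ctensor_map phi F (pid A)) 1 q z'.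
  apply: (etrans Hw); suff -> : w = 0 by exact: linear0.
  apply: cycincl_inj; rewrite linear0; apply: (etrans hw).
  exact: ptensor_map0l.
have s0 z : s K hK p z = 0.
  have E := etrans (esym (s_nat K hK K' hK' c F hF p z))
    (etrans (congr1 (s K' hK' p) (F0 p z)) (linear0 _)).
  have [u hu] := hcls_surj (s K hK p z).
  have [w [hw Hw]] := @induces_homology_map _ _ _ _ _ (ctensor_map phi c (pid A)) 1 p u.
  have /hcls_eq0[y hy] := etrans (esym Hw) (etrans (congr1 _ hu) E).
  apply: (etrans (esym hu)).
  suff -> : u = 0 by exact: linear0.
  apply: cycincl_inj; rewrite linear0.
  have {}E : ptensor_map phi (pid M1) (pid A) p (cycincl 1 (ctensor phi K A) p u) = 0.
    apply: (etrans (esym hw)); apply: (etrans (esym hy)).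
    by apply: ptensor_map0l => q x; apply: (@two_term_d0 M1 (pnull M0) (pzero _ _) (1 + 1) 1).
  exact: etrans (esym (ptensor_map_id _)) E.
have H1 q (x : homology 1 K q) : x = 0.
  have [z <-] := hcls_surj x; suff -> : z = 0 by rewrite linear0.
  apply: cycincl_inj; rewrite linear0; apply: fI; rewrite linear0.
  exact: (cd_cycincl z).
have [z hz] := @cycinclP _ _ _ 1 (ctensor phi K A) p t ft0.
have hz0 : hcls 1 (ctensor phi K A) p z = 0.
  have [_ _ exK] := ex K hK A.
  have b0 : beta K hK A p (hcls 1 (ctensor phi K A) p z) = 0.
    exact: etrans (esym (beta_s K hK p _)) (etrans (congr1 _ (s0 _)) (linear0 _)).
  have [r <-] := (exK p _).1 b0.
  suff -> : r = 0 by exact: linear0.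
  apply: (etrans (esym (ptensor_map_id r))).
  by apply: ptensor_map0l => q x; rewrite (H1 q x).
have [y hy] := (hcls_eq0 _).1 hz0.
apply: (etrans (esym hz)); apply: (etrans (esym hy)).
by apply: ptensor_map0l => q x; apply: (@two_term_d0 M1 M0 f (1 + 1) 1).
Qed.
End MonoTensor.

(** * A monomorphism that tensoring does not preserve *)

Section RankOne.
Context {k : fieldType} {d : Order.disp_t} {P : porderType d}.

Definition constmod : pmod k P.
Proof.
by exists (fun=> [the lmodType k of k^o]) (fun _ _ _ => idfun).
Defined.

(** Such an N is free on e: by c it is k at the elements above [a], and it is zero
elsewhere, so a map out of N amounts to an arbitrary choice of the image of e. *)
Lemma rank_one_projective (N : pmod k P) (c : phom N constmod) a (e : N a) :
  pinj c -> c a e = 1 -> (forall p x, x != 0 :> N p -> (a <= p)%O) -> projective N.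
Proof.
move=> cI ce1 supp X Y u f su.
have [x0 hx0] := su a (f a e).
have cM p q (h : (p <= q)%O) x : c q (pmap N h x) = c p x by rewrite pfun_nat.
have g_ex p : exists g : {linear N p -> X p},
    forall (h : (a <= p)%O) x, g x = (c p x : k) *: pmap X h x0.
  have [h|h] := EM (a <= p)%O; last by exists \0.
  have lin : linear (fun x => (c p x : k) *: pmap X h x0).
    by move=> b x y; rewrite linearP scalerDl scalerA.
  by exists (mklin lin) => h' x; rewrite (bool_irrelevance h' h).
pose g p := projT1 (cid (g_ex p)).
have gE p (h : (a <= p)%O) x : g p x = (c p x : k) *: pmap X h x0.
  exact: projT2 (cid (g_ex p)) h x.
have g_nat p q (h : (p <= q)%O) x : g q (pmap N h x) = pmap X h (g p x).
  have [->|/supp hp] := eqVneq x 0; first by rewrite !linear0.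
  rewrite (gE _ hp) (gE _ (le_trans hp h)) cM linearZ.
  by rewrite -(pmap_comp hp h (le_trans hp h)).
exists (Phom g_nat) => p x; rewrite -[LHS]/(u p (g p x)).
have [->|/supp hp] := eqVneq x 0; first by rewrite !linear0.
rewrite (gE _ hp) linearZ pfun_nat hx0 -pfun_nat -linearZ; congr (f p _).
by apply: cI; rewrite linearZ cM ce1; apply: mulr1.
Qed.
End RankOne.

Section Counterexample.
Variable k : fieldType.

Definition meet_bool (x : bool *p bool) : bool := x.1 && x.2.

Lemma meet_bool_homo : {homo meet_bool : x y / (x <= y)%O}.
Proof. by move=> [[] []] [[] []]. Qed.

(** The direct sum of the two simple modules, k at false and k at true. *)
Definition zeromap_mod : pmod k bool.
Proof.
pose V : lmodType k := [the lmodType k of k^o].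
exists (fun=> V) (fun p q _ => if p == q then (idfun : {linear V -> V}) else \0).
  by move=> p h x; rewrite eqxx.
by move=> [] [] [] // _ _ _ x.
Defined.

Definition const_zeromap : phom constmod zeromap_mod.
Proof.
pose V : lmodType k := [the lmodType k of k^o].
exists (fun p : bool => if p then (\0 : {linear V -> V}) else (idfun : {linear V -> V})).
by move=> [] [].
Defined.

(** The submodule of the constant module generated at true. *)
Definition topsub : psub constmod := pker const_zeromap.

Lemma topsub_false (x : psub_pmod topsub false) : x = 0.
Proof. by apply: pincl_inj; rewrite linear0; apply/eqP; apply: (pincl_mem x). Qed.

Lemma topsub_true : exists e : psub_pmod topsub true, pincl topsub true e = 1.
Proof. by apply: pincl_in; apply/eqP. Qed.

Lemma topsub_projective : projective (psub_pmod topsub).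
Proof.
have [e he] := topsub_true.
apply: (rank_one_projective (c := pincl topsub) (a := true) (@pincl_inj _ _ _ _ _) he).
by move=> [] x //; rewrite (topsub_false x) eqxx.
Qed.

Lemma constmod_projective : projective (constmod : pmod k bool).
Proof.
by apply: (rank_one_projective (c := pid constmod) (a := false) (e := 1)) => // p x y.
Qed.

(** The element is e (x) 1 over (true, false).  It is nonzero: multiplying the two
coordinates defines a functional on the colimit, compatible with the structure
maps because the zero map false -> true of the second factor occurs, below
false, only where the first coordinate is false and the submodule vanishes. *)
Lemma tens_topsub_not_mono :
  exists t, ptensor_map meet_bool (pincl topsub) (pid zeromap_mod) false t = 0 /\ t != 0.
Proof.
have [e he] := topsub_true.
have b10 : below meet_bool false (true, false) by [].
exists (colim_in (ptensor_diag (psub_pmod topsub) zeromap_mod) b10 (tmk e 1)); split.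
  (* Over (false, false), 1 (x) 1 maps to 1 (x) 1 over (true, false) and to
     1 (x) 0 over (false, true), so the three are equal in the colimit. *)
  have b00 : below meet_bool false (false, false) by [].
  have b01 : below meet_bool false (false, true) by [].
  have le1 : ((false, false) <= (true, false) :> (bool *p bool)%type)%O by [].
  have le2 : ((false, false) <= (false, true) :> (bool *p bool)%type)%O by [].
  pose D := ptensor_diag constmod zeromap_mod.
  apply: (etrans (ptensor_mapE _ _ _ _ _)); rewrite he.
  have E1 := colim_in_compat (D := D) b00 b10 le1 (tmk (1 : k^o) (1 : k^o)).
  have E2 := colim_in_compat (D := D) b00 b01 le2 (tmk (1 : k^o) (1 : k^o)).
  have F1 : pmap D le1 (tmk (1 : k^o) (1 : k^o)) = tmk (1 : k^o) (1 : k^o) by exact: tensor_mapE.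
  have F2 : pmap D le2 (tmk (1 : k^o) (1 : k^o)) = 0.
    by apply: (etrans (tensor_mapE _ _ _ _)); apply: tmk0r.
  rewrite F1 in E1; rewrite F2 linear0 in E2.
  exact: etrans E1 (esym E2).
pose X := psub_pmod topsub.
have hl (x : bool *p bool) (v : zeromap_mod x.2) :
    linear (fun u : X x.1 => (pincl topsub x.1 u : k^o) * (v : k^o) : k^o).
  by move=> a u u'; rewrite linearP mulrDl scalerAl.
have hr (x : bool *p bool) (u : X x.1) :
    linear (fun v : zeromap_mod x.2 => (pincl topsub x.1 u : k^o) * (v : k^o) : k^o).
  by move=> a v v'; rewrite mulrDr scalerAr.
pose h x (_ : below meet_bool false x) := tensor_lift (@hl x) (@hr x).
have hh (x y : bool *p bool) (hx : below meet_bool false x)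
    (hy : below meet_bool false y) (le : (x <= y)%O) t :
    h y hy (pmap (ptensor_diag X zeromap_mod) le t) = h x hx t.
  move: t; apply: (@tensor_ext _ _ _ _
    (h y hy \o pmap (ptensor_diag X zeromap_mod) le) (h x hx)) => u v.
  apply: (etrans (congr1 (h y hy) (tensor_mapE _ _ _ _))).
  rewrite !tensor_liftE.
  have -> : pincl topsub y.1 (pmap X (le_pair1 le) u) = pincl topsub x.1 u.
    exact: pfun_nat.
  by case: x y hx hy le u v => [[] []] [[] []] // hx hy le u v;
    rewrite (topsub_false u) linear0 !mul0r.
apply/eqP => t0; have := congr1 (colim_lift hh) t0.
rewrite linear0 colim_liftE tensor_liftE he mulr1; exact/eqP/oner_neq0.
Qed.
End Counterexample.

Theorem theorem5p6 (k : fieldType) :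
  (forall (d : Order.disp_t) (P : porderType d) (phi : P *p P -> P),
     {homo phi : x y / (x <= y)%O} ->
   forall (Q : forall M : pmod k P, presolution M) (n : int), 0 <= n ->
   exists (alpha : kunneth_left_type phi n) (beta : kunneth_right_type phi Q n),
     kunneth_sequence alpha beta /\
     forall (K : cplx k P) (hK : proj_cplx K) (A : pmod k P),
       exists s : phom (Tor phi Q 1 (homology (n - 1) K) A)
                       (homology n (ctensor phi K A)),
         forall p z, beta K hK A p (s p z) = z) /\
  (exists (d : Order.disp_t) (P : porderType d) (phi : P *p P -> P)
      (A : pmod k P) (n : int),
     [/\ {homo phi : x y / (x <= y)%O}, 0 <= n &
     forall (Q : forall M : pmod k P, presolution M)
       (alpha : kunneth_left_type phi n) (beta : kunneth_right_type phi Q n),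
       kunneth_sequence alpha beta ->
       ~ exists s : splitting_type phi Q n A,
           (forall (K : cplx k P) (hK : proj_cplx K) p z,
              beta K hK A p (s K hK p z) = z) /\
           splitting_natural s]).
Proof.
split=> [d P phi _ Q n _|].
  pose alpha : kunneth_left_type (k := k) phi n := fun K _ A =>
    projT1 (cid (left_map_ex phi n K A)).
  have alphaP K hK A : is_left_map (alpha K hK A) by exact: projT2 (cid _).
  pose beta : kunneth_right_type phi Q n := fun K hK A =>
    projT1 (cid (connecting_ex phi A (Q (homology (n - 1) K)) hK)).
  have betaP K hK A : is_connecting (beta K hK A) by exact: projT2 (cid _).
  have split K hK A := connecting_split hK (alphaP K hK A) (betaP K hK A).
  exists alpha, beta; split=> [|K hK A]; last first.
    by have [s [sK _]] := split K hK A; exists s.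
  split.
  - move=> K hK A; have [s [sK ex]] := split K hK A; split.
    + exact: left_map_inj hK (alphaP K hK A).
    + by move=> p z; exists (s p z).
    + move=> p y; split=> [/ex//|[t <-]].
      have H := connecting_left0 hK (alphaP K hK A) (betaP K hK A).
      exact: (H p t).
  - move=> K hK K' hK' A A' f g p x.
    exact: (left_map_natural f g x (alphaP K hK A) (alphaP K' hK' A')).
  - move=> K hK K' hK' A A' f g F hF p x.
    exact: (connecting_natural g x hK (betaP K hK A) (betaP K' hK' A') hF).
exists _, bool, meet_bool, (zeromap_mod k), 1; split=> //.
  exact: meet_bool_homo.
move=> Q alpha beta seq [s [beta_s s_nat]].
have [t [ft0 /eqP]] := tens_topsub_not_mono k; apply.
exact: (not_mono_no_natural_splitting (@topsub_projective k) (@constmod_projective k)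
  (@pincl_inj _ _ _ _ _) seq beta_s s_nat ft0).
Qed.
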